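(* Let $d\geq 3$ be an odd integer. Let $f:\mathbb{R}^n\to\mathbb{R}$ be $d$ times continuously differentiable. Assume that there is a constant $\mu>0$ such that $\nabla^2 f(x)\succeq\mu I$ for all $x\in\mathbb{R}^n$, and that there is a constant $L>0$ such that $\|\nabla^df(y)-\nabla^df(x)\|\leq L\|y-x\|$ for all $x,y\in\mathbb{R}^n$. Let $M\geq L$. Let $g_1,\dots,g_m:\mathbb{R}^n\to\mathbb{R}$ be SOS-convex polynomials such that $C:=\{x\in\mathbb{R}^n:g_i(x)\leq 0,\ i=1,\dots,m\}$ has nonempty interior, and let $x^\ast\in C$ be the unique minimizer of $f$ over $C$. For $x\in\mathbb{R}^n$ define $$\psi_{x,d}(y):=T_{x,d}(y)+\max\left\{\frac{M}{(d+1)!},\,t(x)\right\}\|y-x\|^{d+1},$$ and let $x^+$ denote the optimal solution of the problem of minimizing $\psi_{x,d}(y)$ over $y\in C$. Then: (i) for any starting point $x_0\in\mathbb{R}^n$, the sequence $\{x_k\}_{k=1}^\infty$ defined by $x_{k+1}:=x_k^+$ for $k\geq 0$ converges to $x^\ast$; (ii) for every $x\in\mathbb{R}^n$ satisfying $\|x-x^\ast\|\leq r$, where $r:=\left(\frac{(d-1)!\,\mu}{2L}\right)^{\frac{1}{d-1}}$, $$\|x^{+}-x^{\ast}\|\leq\left(\frac{d+1}{2}\right)^{2}\frac{2}{\mu}\left(\frac{L}{d!}+\max\left\{\frac{M}{(d+1)!},\sup_{\|z-x^{\ast}\|\leq r}t(z)\right\}(d+1)\right)\|x-x^{\ast}\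|^{d}.$$
   Context: $\|\cdot\|$ denotes the Euclidean norm on $\mathbb{R}^n$; the norm of a tensor $A\in\mathbb{R}^{n\times\cdots\times n}$ of order $d$ is $\|A\|=\max_{\|u_1\|=\cdots=\|u_d\|=1}|A[u_1,\dots,u_d]|$. A polynomial is a sum of squares (SOS) if it is a finite sum of squares of real polynomials. A polynomial $p:\mathbb{R}^n\to\mathbb{R}$ is SOS-convex if the polynomial $(x,y)\mapsto\langle\nabla^2p(x)y,y\rangle$ on $\mathbb{R}^n\times\mathbb{R}^n$ is SOS. $T_{x,d}(y):=\sum_{k=0}^{d}\frac{1}{k!}\nabla^kf(x)[y-x,\dots,y-x]$ is the $d$th-order Taylor expansion of $f$ at $x$, where $\nabla^k f(x)$ is the symmetric tensor of $k$th-order partial derivatives, applied to $k$ copies of $y-x$. $t(x):=\min\{t\in\mathbb{R}: t\geq 0,\ y\mapsto T_{x,d}(y)+t\|y-x\|^{d+1}\text{ is SOS-convex}\}$. *)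

(* Defs.v *)
From HB Require Import structures.
From mathcomp Require Import all_boot all_order all_algebra.
From mathcomp Require Import all_classical all_reals all_analysis.
(* mpoly is not imported: its notations clash with those of all_analysis. *)
From mathcomp Require mpoly.

Set Implicit Arguments.
Unset Strict Implicit.
Unset Printing Implicit Defensive.

Import Order.TTheory GRing.Theory Num.Theory.
Import numFieldNormedType.Exports.

Local Open Scope classical_set_scope.
Local Open Scope ring_scope.

(* The topology on 'rV[R]_n is the library's, given by the sup norm; every
   metric quantity below uses the Euclidean norm. *)
Definition enorm (R : realType) (n : nat) (v : 'rV[R]_n) : R :=
  Num.sqrt (\sum_(i < n) v 0 i ^+ 2).

(* ipartial [:: i1; ...; ik] f = d/dx_i1 (... (d/dx_ik f)) *)
Definition ipartial (R : realType) (n : nat) (s : seq 'I_n)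
    (f : 'rV[R]_n -> R) : 'rV[R]_n -> R :=
  foldr (fun (i : 'I_n) (h : 'rV[R]_n -> R) (x : 'rV[R]_n) =>
           'D_(delta_mx 0 i) h x) f s.

(* All partial derivatives up to order k exist and are continuous.  The
   operator 'D_v is total, so existence is required separately. *)
Definition continuously_differentiable (R : realType) (n k : nat)
    (f : 'rV[R]_n -> R) : Prop :=
  (forall s : seq 'I_n, (size s < k)%N ->
     forall (x : 'rV[R]_n) (i : 'I_n), derivable (ipartial s f) x (delta_mx 0 i))
  /\ (forall s : seq 'I_n, (size s <= k)%N -> continuous (ipartial s f)).

(* Tensors of order k on R^n, given by their coordinates. *)
Definition tensor (R : realType) (n k : nat) := {ffun k.-tuple 'I_n -> R}.

Definition tensor_app (R : realType) (n k : nat) (A : tensor R n k)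
    (u : 'I_k -> 'rV[R]_n) : R :=
  \sum_(s : k.-tuple 'I_n) A s * \prod_(j < k) u j 0 (tnth s j).

(* The supremum is attained, by compactness of the unit sphere. *)
Definition tensor_norm (R : realType) (n k : nat) (A : tensor R n k) : R :=
  sup [set `|tensor_app A u| | u in
        [set u : 'I_k -> 'rV[R]_n | forall j, enorm (u j) = 1]].

Definition nabla (R : realType) (n k : nat) (f : 'rV[R]_n -> R)
    (x : 'rV[R]_n) : tensor R n k :=
  [ffun s : k.-tuple 'I_n => ipartial s f x].

Definition hessian (R : realType) (n : nat) (f : 'rV[R]_n -> R)
    (x : 'rV[R]_n) : 'M[R]_n :=
  \matrix_(i < n, j < n) ipartial [:: i; j] f x.

Definition quad_form (R : realType) (n : nat) (A : 'M[R]_n) (v : 'rV[R]_n) : R :=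
  (v *m A *m v^T) 0 0.

Definition psd (R : realType) (n : nat) (A : 'M[R]_n) : Prop :=
  forall v : 'rV[R]_n, 0 <= quad_form A v.

(* Real polynomials are identified with the functions they define. *)
Definition poly_fun (R : realType) (n : nat) (q : mpoly.mpoly n R)
    (x : 'rV[R]_n) : R :=
  mpoly.meval (fun i : 'I_n => x 0 i) q.

Definition is_polynomial (R : realType) (n : nat) (p : 'rV[R]_n -> R) : Prop :=
  exists q : mpoly.mpoly n R, forall x, p x = poly_fun q x.

Definition is_sos (R : realType) (n : nat) (p : 'rV[R]_n -> R) : Prop :=
  exists qs : seq (mpoly.mpoly n R),
    forall x, p x = \sum_(q <- qs) poly_fun q x ^+ 2.

(* A point (x, y) of R^n x R^n is a row vector z of length n + n, with
   x = lsubmx z and y = rsubmx z. *)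
Definition sos_convex (R : realType) (n : nat) (p : 'rV[R]_n -> R) : Prop :=
  is_polynomial p /\
  is_sos (fun z : 'rV[R]_(n + n) => quad_form (hessian p (lsubmx z)) (rsubmx z)).

Definition taylor (R : realType) (n d : nat) (f : 'rV[R]_n -> R)
    (x y : 'rV[R]_n) : R :=
  \sum_(k < d.+1) (k`!%:R)^-1 * tensor_app (nabla k f x) (fun=> y - x).

(* t(x).  The set is nonempty when hessian f x is positive definite and d is
   odd, and closed since sums of squares of bounded degree form a closed cone,
   so the infimum is its minimum. *)
Definition sos_shift (R : realType) (n d : nat) (f : 'rV[R]_n -> R)
    (x : 'rV[R]_n) : R :=
  inf [set t : R | 0 <= t /\
    sos_convex (fun y => taylor d f x y + t * enorm (y - x) ^+ d.+1)].

Definition psi (R : realType) (n d : nat) (f : 'rV[R]_n -> R) (M : R)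
    (x y : 'rV[R]_n) : R :=
  taylor d f x y
  + Num.max (M / d.+1`!%:R) (sos_shift d f x) * enorm (y - x) ^+ d.+1.

Definition feasible (R : realType) (n m : nat) (g : 'I_m -> 'rV[R]_n -> R) :
    set 'rV[R]_n :=
  [set x | forall i, g i x <= 0].

Definition argmin (R : realType) (n : nat) (C : set 'rV[R]_n)
    (h : 'rV[R]_n -> R) : set 'rV[R]_n :=
  [set y | C y /\ forall z, C z -> h y <= h z].

(* x^+, the unique minimizer of psi_{x,d} over C; it is 0 if existence or
   uniqueness fails. *)
Definition newton_step (R : realType) (n d : nat) (f : 'rV[R]_n -> R) (M : R)
    (C : set 'rV[R]_n) (x : 'rV[R]_n) : 'rV[R]_n :=
  xget 0 [set y | argmin C (psi d f M x) = [set y]].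

(* Main.v *)
Require Import Defs.
From HB Require Import structures.
From mathcomp Require Import all_boot all_order all_algebra.
From mathcomp Require Import all_classical all_reals all_analysis.
From mathcomp Require mpoly.
(* The notations of mpoly clash with those of all_analysis, but its ring
   instances are needed. *)
Import (canonicals) mpoly.
From mathcomp Require Import ring lra zify.

(** Let [h = y - x].  Since [f <= psi_x <= f + K |h|^(d+1)] with [K] bounded for [x]
    in a ball, comparing [psi_x] at the new iterate with its value on the segment
    from [x] to [xs] gives
    [f x^+ - f xs <= (1 - a) (f x - f xs) + K' a^(d+1)] for all [a] in [0, 1], whence
    the convergence.

    The boundedness of [K] needs a locally uniform bound on [t(x)].  The Hessian form
    [<D^2 T v, v>] is a constant form [>= mu |v|^2] plus monomials
    [h^s v_i v_j] with [0 < |s| < d - 1], and each of these is dominated, modulo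
    sums of squares, by [e |v|^2 + C |h|^(d-1) |v|^2].

    For the local rate put [w = x^+ - xs] and [p s = psi_x (xs + s w)].  Optimality of
    [x^+] and [xs] gives [p' 1 - p' 0 <= C |x - xs|^d |w|].  The polynomial [p''] has
    degree [<= d - 1 = 2k] and is a limit of sums of squares, so [p' 1 - p' 0],
    which is the integral of [p''] over [0, 1], is at least [p'' 0 / (k + 1)^2]; this
    is the value at 0 of the reproducing kernel of the polynomials of degree [<= k]
    on [0, 1].  Finally [p'' 0 >= mu/2 |w|^2] by Taylor's formula for the Hessian. *)

Set Implicit Arguments.
Unset Strict Implicit.
Unset Printing Implicit Defensive.

Import Order.TTheory GRing.Theory Num.Theory.
Import numFieldNormedType.Exports.

Local Open Scope classical_set_scope.
Local Open Scope ring_scope.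

(** * One-variable calculus *)

(** The obstacle in the local rate: the Hessian of psi_x is bounded below by mu/2 at [xs], but x^+
    may lie where no such bound is at hand, and convexity alone would let p'' collapse right after
    0. A sum of squares of degree at most 2k can only drop as fast as its degree permits, which the
    kernel measures; with 2k = d - 1 the loss (k + 1)^2 is the factor ((d + 1)/2)^2 of (ii). The
    radius r is where the Taylor error L |x - xs|^(d-1) / (d-1)! of the Hessian reaches mu/2. The
    number t(x) enters as an infimum: each property of psi_x is written as an inequality affine in
    the weight of |y - x|^(d+1), valid for every SOS-convex shift, and is passed to the limit. As
    psi_x is merely known to be convex, existence and uniqueness of x^+ are drawn from f <= psi_x:
    the quadratic growth of f makes psi_x coercive, and two minimizers would make psi_x constant on
    a whole line, where it could not dominate the strongly convex f. *)

Lemma mvt_derive (R : realType) (f df : R -> R) (a b : R) :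
  (forall x, is_derive x (1 : R) f (df x)) -> a <= b ->
  exists2 c, a <= c <= b & f b - f a = df c * (b - a).
Proof.
move=> fdf ab.
have [|c cab e] := @MVT_segment R f df a b ab (fun x _ => fdf x).
  apply: derivable_within_continuous => x _; exact: (@ex_derive _ _ _ _ _ _ _ (fdf x)).
by exists c => //; move: cab; rewrite in_itv.
Qed.

Lemma ge0_derive_le (R : realType) (f df : R -> R) (a b : R) :
  (forall x, is_derive x (1 : R) f (df x)) ->
  (forall x, a <= x <= b -> 0 <= df x) -> a <= b -> f a <= f b.
Proof.
move=> fdf df0 ab; have [c cab e] := mvt_derive fdf ab.
by rewrite -subr_ge0 e mulr_ge0 ?subr_ge0 ?df0.
Qed.

Lemma derive_dominated (R : realType) (f df g dg : R -> R) :
  (forall x, is_derive x (1 : R) f (df x)) ->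
  (forall x, is_derive x (1 : R) g (dg x)) ->
  f 0 = 0 -> g 0 = 0 -> (forall x, 0 <= x -> `|df x| <= dg x) ->
  forall x, 0 <= x -> `|f x| <= g x.
Proof.
move=> fdf gdg f0 g0 le_d x x0; rewrite ler_norml; apply/andP; split.
  have := @ge0_derive_le R (g + f) (fun x => dg x + df x) 0 x
    (fun y => is_deriveD _ _) _ x0.
  rewrite /= !fctE f0 g0 addr0 => H.
  rewrite lerNl -subr_ge0 opprK H // => y /andP[/le_d + _].
  by rewrite ler_norml => /andP[+ _]; rewrite lerNl -subr_ge0 opprK.
have := @ge0_derive_le R (g - f) (fun x => dg x - df x) 0 x
  (fun y => is_deriveB _ _) _ x0.
rewrite /= !fctE f0 g0 subr0 => H.
rewrite -subr_ge0 H // => y /andP[/le_d + _].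
by rewrite ler_norml => /andP[_]; rewrite subr_ge0.
Qed.

(** Here [a k] plays the k-th derivative of [a 0], and the top one is only Lipschitz at 0. By
    induction on [n], the estimate for the shifted sequence bounds the derivative of the remainder,
    and [derive_dominated] integrates that bound. *)
Lemma taylor_lipschitz (R : realType) (a : nat -> R -> R) (K : R) (n : nat) :
  (forall k s, (k < n)%N -> is_derive s (1 : R) (a k) (a k.+1 s)) ->
  (forall s, 0 <= s -> `|a n s - a n 0| <= K * s) ->
  forall s, 0 <= s ->
    `|a 0%N s - \sum_(k < n.+1) k`!%:R^-1 * a k 0 * s ^+ k|
    <= K * s ^+ n.+1 / n.+1`!%:R.
Proof.
elim: n a => [|n IH] a da lip s s0.
  by rewrite big_ord1 expr0 expr1 fact0 (_ : 1`! = 1%N) // invr1 !mulr1 mul1r; apply: lip.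
have {}IH := IH (fun k => a k.+1) (fun k t kn => da k.+1 t kn) lip.
pose p : {poly R} := \poly_(k < n.+2) (k`!%:R^-1 * a k 0).
pose q : {poly R} := (K / n.+2`!%:R) *: 'X^(n.+2).
have pE t : p.[t] = \sum_(k < n.+2) k`!%:R^-1 * a k 0 * t ^+ k.
  by rewrite horner_poly.
have qE t : q.[t] = K * t ^+ n.+2 / n.+2`!%:R by rewrite hornerZ hornerXn mulrAC.
have fact0 k : k`!%:R != 0 :> R by rewrite pnatr_eq0 gtn_eqF ?fact_gt0.
have dpE t : p^`().[t] = \sum_(k < n.+1) k`!%:R^-1 * a k.+1 0 * t ^+ k.
  have -> : p^`() = \poly_(k < n.+1) (k`!%:R^-1 * a k.+1 0).
    apply/polyP => k; rewrite coef_deriv !coef_poly ltnS.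
    case: ifP; rewrite ?mul0rn // => _; rewrite factS natrM -mulr_natr.
    by field; rewrite fact0 nat1r pnatr_eq0.
  by rewrite horner_poly.
rewrite -pE -qE.
apply: (@derive_dominated R (a 0%N - horner p) (fun t => a 1%N t - p^`().[t])
   (horner q) (horner q^`())) => //.
- by move=> t; apply: is_deriveB; apply: da.
- rewrite !fctE pE big_ord_recl big1 ?addr0 ?expr0 ?mulr1 ?invr1 ?mul1r ?subrr //.
  by move=> i _; rewrite lift0 expr0n mulr0.
- by rewrite qE expr0n mulr0 mul0r.
- move=> t t0; rewrite dpE (le_trans (IH t t0)) // derivZ derivXn hornerZ hornerMn hornerXn.
  rewrite [n.+2`!]factS natrM /= -mulr_natl.
  rewrite le_eqVlt; apply/orP; left; apply/eqP; field.
  by rewrite fact0 /= -natrD pnatr_eq0.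
Qed.

Lemma convex_of_second_derivative (R : realType) (f df ddf : R -> R) (k : R) :
  (forall x, is_derive x (1 : R) f (df x)) ->
  (forall x, is_derive x (1 : R) df (ddf x)) ->
  (forall x, k <= ddf x) ->
  forall a, 0 <= a <= 1 ->
    f a <= (1 - a) * f 0 + a * f 1 - k / 2 * (a * (1 - a)).
Proof.
move=> fdf dfddf kdd a /andP[a0 a1].
pose p : {poly R} := (k / 2) *: 'X^2.
have dpE x : p^`().[x] = k * x.
  by rewrite derivZ derivXn hornerZ hornerMn hornerXn /= expr1; field.
have dh x : is_derive x (1 : R) (f - horner p) (df x - p^`().[x]).
  exact: is_deriveB.
have mono x y : x <= y -> df x - p^`().[x] <= df y - p^`().[y].
  move=> xy; apply: (@ge0_derive_le R (df - horner p^`())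
    (fun t => ddf t - p^`()^`().[t]) x y _ _ xy) => z _.
  rewrite subr_ge0; have -> : p^`()^`() = k%:P; last by rewrite hornerC.
  by rewrite derivZ derivXn derivZ derivMn derivX; apply/polyP=> i;
    rewrite !coefE; case: eqP => _ /=; rewrite ?mul0rn ?mulr0 //; field.
have [c1 /andP[c1a c1b] e1] := mvt_derive dh a0.
have [c2 /andP[c2a c2b] e2] := mvt_derive dh a1.
have := mono c1 c2 (le_trans c1b c2a).
move: e1 e2; rewrite !fctE /p !hornerE /= => e1 e2 le12.
set u := _ - _ in le12; set v := _ - _ in le12.
rewrite -/u -/v in e1 e2.
(* The mean value equations on [0, a] and [a, 1], weighted by 1 - a and a, differ by exactly this
   quantity, [u] and [v] being the two slopes. *)
have h : 0 <= (a * (1 - a)) * (v - u).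
  by rewrite !mulr_ge0 ?subr_ge0.
have {}e1 := congr1 (fun z => (1 - a) * z) e1.
have {}e2 := congr1 (fun z => a * z) e2.
move: e1 e2 h; clearbody u v; rewrite /= => e1 e2 h; lra.
Qed.

(** * An extremal inequality for polynomials on the unit interval *)

(** The integral of [q] over [0, 1], computed from the coefficients; this reduces everything below
    to algebra and monotonicity. *)
Definition unit_integral (R : realType) (q : {poly R}) : R :=
  \sum_(k < size q) q`_k / k.+1%:R.

Lemma unit_integralE (R : realType) (q : {poly R}) N : (size q <= N)%N ->
  unit_integral q = \sum_(k < N) q`_k / k.+1%:R.
Proof.
move=> sq; rewrite /unit_integral (big_ord_widen N (fun k => q`_k / k.+1%:R) sq).
rewrite big_mkcond; apply: eq_bigr => k _.
by case: ltnP => // /(nth_default 0) ->; rewrite mul0r.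
Qed.

Lemma unit_integralD (R : realType) (p q : {poly R}) :
  unit_integral (p + q) = unit_integral p + unit_integral q.
Proof.
pose N := maxn (size p) (size q).
rewrite !(@unit_integralE _ _ N) ?leq_maxl ?leq_maxr ?size_polyD //.
by rewrite -big_split; apply: eq_bigr => k _; rewrite coefD mulrDl.
Qed.

Lemma unit_integralZ (R : realType) a (p : {poly R}) :
  unit_integral (a *: p) = a * unit_integral p.
Proof.
rewrite (@unit_integralE _ (a *: p) (size p)) ?size_scale_leq // mulr_sumr.
by apply: eq_bigr => k _; rewrite coefZ mulrA.
Qed.

Lemma unit_integral0 (R : realType) : unit_integral (0 : {poly R}) = 0.
Proof. by rewrite /unit_integral size_poly0 big_ord0. Qed.

Lemma unit_integral_sum (R : realType) (I : Type) (s : seq I) (F : I -> {poly R}) :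
  unit_integral (\sum_(i <- s) F i) = \sum_(i <- s) unit_integral (F i).
Proof. exact: (big_morph _ (@unit_integralD R) (@unit_integral0 R)). Qed.

Lemma unit_integral_deriv (R : realType) (p : {poly R}) :
  unit_integral p^`() = p.[1] - p.[0].
Proof.
have sd : (size p^`() <= (size p).-1)%N by rewrite size_poly.
rewrite (unit_integralE sd) -[p in RHS]coefK !horner_poly.
case: (size p) => [|n]; first by rewrite !big_ord0 subrr.
rewrite !big_ord_recl /= !expr0 [X in _ - (_ + X)]big1 ?addr0; last first.
  by move=> i _; rewrite expr0n mulr0.
rewrite addrAC subrr add0r; apply: eq_bigr => k _.
by rewrite coef_deriv expr1n mulr1 -(mulr_natr p`_k.+1) mulfK // pnatr_eq0.
Qed.

Lemma unit_integral_ge0 (R : realType) (q : {poly R}) :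
  (forall x, 0 <= q.[x]) -> 0 <= unit_integral q.
Proof.
(* An antiderivative of [q]. Its coefficient of index 0 is a division by zero, hence 0, and
   differentiation removes it anyway. *)
move=> q0; pose p := \poly_(k < (size q).+1) (q`_k.-1 / k%:R).
have dp : p^`() = q.
  apply/polyP => k; rewrite coef_deriv coef_poly ltnS.
  case: ltnP => [_|/(nth_default 0) ->]; last by rewrite mul0rn.
  by rewrite -(mulr_natr (_ / _)) divfK // pnatr_eq0.
rewrite -dp unit_integral_deriv subr_ge0.
by apply: (@ge0_derive_le R (horner p) (horner p^`())) => // x _; rewrite dp.
Qed.

(** Lagrange interpolation of [p] at the [n] nodes, divided by the nodal polynomial. *)
Lemma partial_fractions (F : fieldType) (n : nat) (x : nat -> F) (p : {poly F}) z :
  (0 < n)%N -> injective x -> (size p <= n)%N ->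
  (forall i : 'I_n, z - x i != 0) ->
  p.[z] / \prod_(j < n) (z - x j) =
  \sum_(i < n) p.[x i] / \prod_(j < n | j != i) (x i - x j) / (z - x i).
Proof.
move=> n0 xI sp zx; rewrite {1}(lagrange_gen n0 xI sp) horner_sum mulr_suml.
apply: eq_bigr => i _; rewrite hornerM hornerC (lagrangeE n0 xI) /= hornerM hornerC.
rewrite !horner_prod.
have -> : \prod_(j < n) (z - x j) = (z - x i) * \prod_(j < n | j != i) (z - x j).
  by rewrite (bigD1 i).
under eq_bigr => j _ do rewrite hornerXsubC.
under [X in _ * (_ * X) / _]eq_bigr => j _ do rewrite hornerXsubC.
have : \prod_(j < n | j != i) (z - x j) != 0 by apply/prodf_neq0 => j _.
move: (\prod_(j < n | j != i) (z - x j)) => b b0.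
have : \prod_(j < n | j != i) (x i - x j) != 0.
  by apply/prodf_neq0 => j ji; rewrite subr_eq0 (inj_eq xI) eq_sym.
move: (\prod_(j < n | j != i) (x i - x j)) => a a0.
have := zx i; move: (z - x i) => c c0; field; by rewrite a0 b0 c0.
Qed.

Lemma prod_natr_succ (R : realType) m :
  \prod_(j < m) (j.+1)%:R = (m`!)%:R :> R.
Proof.
elim: m => [|m IH]; first by rewrite big_ord0.
by rewrite big_ord_recr /= IH factS mulnC natrM.
Qed.

Lemma prod_natr_succ2 (R : realType) m :
  \prod_(j < m) (j.+2)%:R = (m.+1`!)%:R :> R.
Proof.
elim: m => [|m IH]; first by rewrite big_ord0.
by rewrite big_ord_recr /= IH (factS m.+1) mulnC natrM.
Qed.

(* The reproducing kernel at 0 of the polynomials of degree at most m in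
   L^2(0, 1).  Its coefficients are the partial fraction coefficients of
   (-1)^m (m + 1) (X - 1) ... (X - m) / ((X + 1) ... (X + m + 1)). *)
Lemma endpoint_kernel (R : realType) (m : nat) :
  exists K : {poly R}, [/\ (size K <= m.+1)%N, K.[0] = m.+1%:R ^+ 2 &
    forall r : {poly R}, (size r <= m.+1)%N -> unit_integral (r * K) = r.[0]].
Proof.
pose x (i : nat) : R := - i.+1%:R.
have xI : injective x.
  by move=> i j /eqP; rewrite eqr_opp eqr_nat eqSS => /eqP.
(* Normalized so that [Q] divided by the product of the z - x i takes the value 1 at z = 0. *)
pose c : R := (-1) ^+ m * m.+1%:R.
pose Q : {poly R} := c *: \prod_(j < m) ('X - (j.+1%:R)%:P).
have sQ : (size Q <= m.+1)%N.
  rewrite (leq_trans (size_scale_leq _ _)) // size_prod_XsubC.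
  by rewrite /index_enum -enumT size_enum_ord.
pose k0 (i : 'I_m.+1) := Q.[x i] / \prod_(j < m.+1 | j != i) (x i - x j).
pose K := \poly_(k < m.+1) k0 (inord k).
have KE (k : 'I_m.+1) : K`_k = k0 k by rewrite coef_poly ltn_ord inord_val.
(* The sum is the integral of X^j K over [0, 1], because j - x k = j + k + 1. The zeros 1, ..., m of
   [Q] therefore make K orthogonal to X, ..., X^m. *)
have pf (j : nat) : Q.[j%:R] / \prod_(i < m.+1) (j%:R - x i) =
    \sum_(k < m.+1) K`_k / (j + k).+1%:R.
  rewrite (partial_fractions _ xI) //; last first.
    by move=> i; rewrite opprK -natrD pnatr_eq0 addnS.
  by apply: eq_bigr => k _; rewrite KE opprK -natrD addnS.
have fact0 k : k`!%:R != 0 :> R by rewrite pnatr_eq0 gtn_eqF ?fact_gt0.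
have sgn2 : (-1) ^+ m * (-1) ^+ m = 1 :> R by rewrite -exprMn mulrNN mulr1 expr1n.
have prN (F : 'I_m -> R) : \prod_j - F j = (-1) ^+ m * \prod_j F j.
  under eq_bigr do rewrite -mulN1r.
  by rewrite big_split prodr_const card_ord.
have QE z : Q.[z] = c * \prod_(j < m) (z - j.+1%:R).
  by rewrite hornerZ horner_prod; congr (_ * _); apply: eq_bigr => j _;
     rewrite hornerXsubC.
exists K; split; first exact: size_poly.
  rewrite horner_coef0 (KE ord0) /k0 QE.
  have -> : \prod_(j < m) (x (@ord0 m) - j.+1%:R) = (-1) ^+ m * m.+1`!%:R.
    rewrite -prod_natr_succ2 -prN.
    by apply: eq_bigr => j _ /=; rewrite /x -[j.+2]add1n natrD opprD.
  have -> : \prod_(j < m.+1 | j != ord0) (x (@ord0 m) - x j) = m`!%:R.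
    rewrite big_mkcond big_ord_recl /= mul1r -prod_natr_succ.
    apply: eq_bigr => j _ /=; rewrite /x opprK -[(bump 0 j).+1]add1n natrD /bump leq0n.
    by rewrite addrA addNr add0r.
  rewrite /c factS natrM mulrACA sgn2.
  by field; rewrite fact0.
move=> r sr.
have I j : (j < m.+1)%N -> unit_integral ('X^j * K) = (j == 0%N)%:R.
  move=> jm; rewrite (@unit_integralE _ _ (j + m.+1)); last first.
    rewrite (leq_trans (size_polyMleq _ _)) // size_polyXn addSn /=.
    by rewrite leq_add2l size_poly.
  rewrite big_split_ord /= big1 ?add0r; last first.
    by move=> i _; rewrite coefXnM ltn_ord mul0r.
  transitivity (\sum_(k < m.+1) K`_k / (j + k).+1%:R).
    by apply: eq_bigr => k _; rewrite coefXnM ltnNge leq_addr /= addKn.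
  rewrite -pf QE; case: j jm => [_|j jm] /=.
    have -> : \prod_(j < m) (0 - j.+1%:R) = (-1) ^+ m * m`!%:R :> R.
      by rewrite -prod_natr_succ -prN; apply: eq_bigr => j _; rewrite sub0r.
    have -> : \prod_(i < m.+1) (0%:R - x i) = m.+1`!%:R.
      rewrite -prod_natr_succ; apply: eq_bigr => i _.
      by rewrite opprK add0r.
    rewrite /c factS natrM mulrACA sgn2 mul1r divff // mulf_neq0 ?fact0 ?pnatr_eq0.
  rewrite ltnS in jm.
  by rewrite (bigD1 (Ordinal jm)) //= subrr mul0r mulr0 mul0r.
have -> : r * K = \sum_(j < m.+1) r`_j *: ('X^j * K).
  rewrite -{1}[r]coefK (poly_def (size r)).
  rewrite (big_ord_widen m.+1 (fun j => r`_j *: 'X^j) sr) mulr_suml.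
  rewrite big_mkcond; apply: eq_bigr => j _.
  by case: ltnP => [_|/(nth_default 0) ->]; rewrite -?scalerAl // scale0r.
rewrite unit_integral_sum big_ord_recl unit_integralZ I // mulr1 horner_coef0.
by rewrite big1 ?addr0 // => j _; rewrite unit_integralZ I ?mulr0 // lift0 ltnS.
Qed.

(** Cauchy-Schwarz for the evaluation at 0, which K represents: l K is the projection of [r] onto K,
    and the squared norm of r - l K is nonnegative. *)
Lemma sqr_le_unit_integral (R : realType) (m : nat) (r : {poly R}) :
  (size r <= m.+1)%N -> r.[0] ^+ 2 / m.+1%:R ^+ 2 <= unit_integral (r ^+ 2).
Proof.
move=> sr; have [K [sK K0 IK]] := endpoint_kernel R m.
pose l := r.[0] / m.+1%:R ^+ 2.
have : 0 <= unit_integral ((r - l *: K) ^+ 2).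
  by apply: unit_integral_ge0 => x; rewrite horner_exp sqr_ge0.
have -> : (r - l *: K) ^+ 2 = r ^+ 2 + ((- 2 * l) *: (r * K) + (l ^+ 2) *: (K * K)).
  rewrite -!mul_polyC !rmorphM rmorphN /= expr2; ring.
rewrite !unit_integralD !unit_integralZ !IK // K0 /l.
set a := unit_integral _; set b := r.[0] => H; rewrite -subr_ge0.
have m0 : m.+1%:R != 0 :> R by rewrite pnatr_eq0.
suff -> : a - b ^+ 2 / m.+1%:R ^+ 2 = a + (-2 * (b / m.+1%:R ^+ 2) * b +
  (b / m.+1%:R ^+ 2) ^+ 2 * m.+1%:R ^+ 2) by [].
by field; rewrite nat1r.
Qed.

(** Leading terms of squares cannot cancel: if the largest size [M] exceeded m + 1, the coefficient
    of degree 2(M - 1) of the sum would vanish while being the sum of the squares of the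
    coefficients of degree M - 1. *)
Lemma size_le_of_sum_sqr (R : realType) (m : nat) (rs : seq {poly R}) :
  (size (\sum_(r <- rs) r ^+ 2)%R <= (2 * m).+1)%N ->
  forall r, r \in rs -> (size r <= m.+1)%N.
Proof.
move=> ss; pose M := (\max_(r <- rs) size r)%N.
have sM r : r \in rs -> (size r <= M)%N by move=> /leq_bigmax_seq ->.
suff MM : (M <= m.+1)%N by move=> r /sM /leq_trans ->.
rewrite leqNgt; apply/negP => mM.
have M1 : M = M.-1.+1 by case: (M) mM.
have cf (r : {poly R}) : (size r <= M)%N -> (r ^+ 2)`_(2 * M.-1) = r`_M.-1 ^+ 2.
  move=> sr; rewrite expr2 coefM mul2n -addnn.
  have lt : (M.-1 < (M.-1 + M.-1).+1)%N by rewrite ltnS leq_addr.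
  rewrite (bigD1 (Ordinal lt)) //= addnK -expr2 big1 ?addr0 // => i.
  rewrite -val_eqE /= => ne; have [iM|iM|iM] := ltngtP i M.-1.
  - rewrite [X in _ * X]nth_default ?mulr0 // (leq_trans sr) //.
    by move: (i : nat) iM M1; clear=> i' iM M1; lia.
  - by rewrite nth_default ?mul0r // (leq_trans sr) //; move: (i : nat) iM M1; clear=> i' iM M1; lia.
  - by rewrite iM eqxx in ne.
have : (\sum_(r <- rs) r ^+ 2)`_(2 * M.-1) = 0.
  rewrite nth_default // (leq_trans ss) // ltn_mul2l /=.
  by rewrite -ltnS -M1.
rewrite coef_sum big_seq (eq_bigr (fun r : {poly R} => r`_M.-1 ^+ 2)); last first.
  by move=> r /sM/cf.
move=> /eqP; rewrite -big_seq psumr_eq0 => [/allP H|r _]; last exact: sqr_ge0.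
have : (M <= M.-1)%N; last by rewrite [X in (X <= _)%N]M1 ltnn.
apply/bigmax_leqP_seq => r rs_r _; rewrite leqNgt; apply/negP => lt.
have sr : size r = M by apply/eqP; rewrite eqn_leq sM // M1.
have := H r rs_r; rewrite /= sqrf_eq0 -sr -/(lead_coef r) lead_coef_eq0.
by move=> /eqP r0; move: lt; rewrite r0 size_poly0.
Qed.

Lemma sos_second_derivative_le (R : realType) (m : nat) (p : {poly R}) (rs : seq {poly R}) :
  (size p <= (2 * m).+3)%N -> p^`()^`() = \sum_(r <- rs) r ^+ 2 ->
  p^`()^`().[0] / m.+1%:R ^+ 2 <= p^`().[1] - p^`().[0].
Proof.
move=> sp pE; rewrite -unit_integral_deriv pE unit_integral_sum horner_sum mulr_suml.
have sd : (size (\sum_(r <- rs) r ^+ 2)%R <= (2 * m).+1)%N.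
  have h1 : (size p^`() <= (size p).-1)%N by rewrite size_poly.
  have h2 : (size p^`()^`() <= (size p^`()).-1)%N by rewrite size_poly.
  rewrite -pE; lia.
rewrite big_seq [leRHS]big_seq; apply: ler_sum => r rr.
rewrite horner_exp; exact/sqr_le_unit_integral/(size_le_of_sum_sqr sd).
Qed.

(** * Polynomial functions and sums of squares *)

Section polynomial_functions.
Variables (R : realType) (n : nat).
Implicit Types p q : 'rV[R]_n -> R.

Lemma is_polynomial_ext p q : p =1 q -> is_polynomial q -> is_polynomial p.
Proof. by move=> pq [r rq]; exists r => x; rewrite pq rq. Qed.

Lemma is_polynomial_cst c : is_polynomial (fun _ : 'rV[R]_n => c).
Proof. by exists (mpoly.mpolyC n c) => x; rewrite /poly_fun mpoly.mevalC. Qed.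

Lemma is_polynomial_coord i : is_polynomial (fun x : 'rV[R]_n => x 0 i).
Proof.
by exists (mpoly.mpolyX R (mpoly.mnm1 i)) => x; rewrite /poly_fun mpoly.mevalXU.
Qed.

Lemma is_polynomialD p q :
  is_polynomial p -> is_polynomial q -> is_polynomial (fun x => p x + q x).
Proof.
move=> [r rp] [s sq]; exists (r + s) => x.
by rewrite /poly_fun mpoly.mevalD rp sq.
Qed.

Lemma is_polynomialM p q :
  is_polynomial p -> is_polynomial q -> is_polynomial (fun x => p x * q x).
Proof.
move=> [r rp] [s sq]; exists (r * s) => x.
by rewrite /poly_fun mpoly.mevalM rp sq.
Qed.

Lemma is_polynomialZ c p : is_polynomial p -> is_polynomial (fun x => c * p x).
Proof. by move=> pp; apply: is_polynomialM => //; exact: is_polynomial_cst. Qed.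

Lemma is_polynomialB p q :
  is_polynomial p -> is_polynomial q -> is_polynomial (fun x => p x - q x).
Proof.
move=> [r rp] [s sq]; exists (r - s) => x.
by rewrite /poly_fun mpoly.mevalB rp sq.
Qed.

Lemma is_polynomial_sum (I : Type) (s : seq I) (F : I -> 'rV[R]_n -> R) :
  (forall i, is_polynomial (F i)) -> is_polynomial (fun x => \sum_(i <- s) F i x).
Proof.
move=> H; elim: s => [|i s IH].
  by apply: is_polynomial_ext (is_polynomial_cst 0) => x; rewrite big_nil.
by apply: is_polynomial_ext (is_polynomialD (H i) IH) => x; rewrite big_cons.
Qed.

Lemma is_polynomial_prod (I : Type) (s : seq I) (F : I -> 'rV[R]_n -> R) :
  (forall i, is_polynomial (F i)) -> is_polynomial (fun x => \prod_(i <- s) F i x).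
Proof.
move=> H; elim: s => [|i s IH].
  by apply: is_polynomial_ext (is_polynomial_cst 1) => x; rewrite big_nil.
by apply: is_polynomial_ext (is_polynomialM (H i) IH) => x; rewrite big_cons.
Qed.

Lemma is_polynomialX p k : is_polynomial p -> is_polynomial (fun x => p x ^+ k).
Proof.
move=> pp; elim: k => [|k IH].
  by apply: is_polynomial_ext (is_polynomial_cst 1) => x; rewrite expr0.
by apply: is_polynomial_ext (is_polynomialM pp IH) => x; rewrite exprS.
Qed.

Lemma is_polynomial_ind (P : ('rV[R]_n -> R) -> Prop) :
  (forall p q, p =1 q -> P q -> P p) ->
  (forall c, P (fun=> c)) -> (forall i, P (fun x => x 0 i)) ->
  (forall p q, is_polynomial p -> is_polynomial q -> P p -> P q ->
     P (fun x => p x + q x)) ->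
  (forall p q, is_polynomial p -> is_polynomial q -> P p -> P q ->
     P (fun x => p x * q x)) ->
  forall p, is_polynomial p -> P p.
Proof.
move=> Pext Pc Px PD PM p [q pE].
suff [] : P (poly_fun q) /\ is_polynomial (poly_fun q) by move=> + _; apply: Pext.
(* Polynomiality is carried along because the clauses for sums and products require it of both
   arguments. *)
pose PP p := P p /\ is_polynomial p.
have PPM p1 p2 : PP p1 -> PP p2 -> PP (fun x => p1 x * p2 x).
  by move=> [? ?] [? ?]; split; [exact: PM|exact: is_polynomialM].
have PPc c : PP (fun=> c) by split; [exact: Pc|exact: is_polynomial_cst].
have PPext p1 p2 : p1 =1 p2 -> PP p2 -> PP p1.
  by move=> e [? ?]; split; [exact: Pext e _|exact: is_polynomial_ext e _].
have PPsum (I : Type) (s : seq I) (F : I -> 'rV[R]_n -> R) :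
    (forall i, PP (F i)) -> PP (fun x => \sum_(i <- s) F i x).
  move=> H; elim: s => [|i s [IH1 IH2]].
    by apply: PPext (PPc 0) => x; rewrite big_nil.
  apply: (@PPext _ (fun x => F i x + \sum_(i <- s) F i x)).
    by move=> x; rewrite big_cons.
  by have [? ?] := H i; split; [exact: PD|exact: is_polynomialD].
have PPprod (I : Type) (s : seq I) (F : I -> 'rV[R]_n -> R) :
    (forall i, PP (F i)) -> PP (fun x => \prod_(i <- s) F i x).
  move=> H; elim: s => [|i s IH].
    by apply: PPext (PPc 1) => x; rewrite big_nil.
  by apply: PPext (PPM _ _ (H i) IH) => x; rewrite big_cons.
have PPX p1 k : PP p1 -> PP (fun x => p1 x ^+ k).
  move=> H; elim: k => [|k IH].
    by apply: PPext (PPc 1) => x; rewrite expr0.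
  by apply: PPext (PPM _ _ H IH) => x; rewrite exprS.
rewrite -/(PP (poly_fun q)).
apply: PPext (fun x => mpoly.mevalE (fun i : 'I_n => x 0 i) q) _.
apply: PPsum => m; apply: PPM => //; apply: PPprod => i; apply: PPX.
by split; [exact: Px|exact: is_polynomial_coord].
Qed.

Lemma is_sos_ext p q : p =1 q -> is_sos q -> is_sos p.
Proof. by move=> pq [r rq]; exists r => x; rewrite pq rq. Qed.

Lemma is_sosD p q : is_sos p -> is_sos q -> is_sos (fun x => p x + q x).
Proof. by move=> [r rp] [s sq]; exists (r ++ s) => x; rewrite big_cat rp sq. Qed.

Lemma is_sos_sqr p : is_polynomial p -> is_sos (fun x => p x ^+ 2).
Proof. by move=> [q pq]; exists [:: q] => x; rewrite big_seq1 pq. Qed.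

Lemma is_sos0 : is_sos (fun _ : 'rV[R]_n => 0 : R).
Proof. by exists [::] => x; rewrite big_nil. Qed.

Lemma is_sos_sum (I : Type) (s : seq I) (F : I -> 'rV[R]_n -> R) :
  (forall i, is_sos (F i)) -> is_sos (fun x => \sum_(i <- s) F i x).
Proof.
move=> H; elim: s => [|i s IH].
  by apply: is_sos_ext is_sos0 => x; rewrite big_nil.
by apply: is_sos_ext (is_sosD (H i) IH) => x; rewrite big_cons.
Qed.

Lemma is_sosM p q : is_sos p -> is_sos q -> is_sos (fun x => p x * q x).
Proof.
move=> [r rp] [s sq]; exists [seq a * b | a <- r, b <- s] => x.
rewrite rp sq big_allpairs_dep mulr_suml; apply: eq_bigr => a _.
rewrite mulr_sumr; apply: eq_bigr => b _.
by rewrite /poly_fun mpoly.mevalM exprMn.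
Qed.

Lemma is_sos_cst c : 0 <= c -> is_sos (fun _ : 'rV[R]_n => c).
Proof.
move=> c0; apply: is_sos_ext (is_sos_sqr (is_polynomial_cst (Num.sqrt c))) => x.
by rewrite sqr_sqrtr.
Qed.

Lemma is_sosZ c p : 0 <= c -> is_sos p -> is_sos (fun x => c * p x).
Proof. by move=> c0; apply/is_sosM/is_sos_cst. Qed.

Lemma is_sosX p k : is_sos p -> is_sos (fun x => p x ^+ k).
Proof.
move=> pp; elim: k => [|k IH].
  by apply: is_sos_ext (is_sos_cst ler01) => x; rewrite expr0.
by apply: is_sos_ext (is_sosM pp IH) => x; rewrite exprS.
Qed.

Lemma is_sos_ge0 p : is_sos p -> forall x, 0 <= p x.
Proof. by move=> [r rp] x; rewrite rp sumr_ge0 // => q _; rewrite sqr_ge0. Qed.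

End polynomial_functions.

Lemma is_polynomial_comp (R : realType) (n N : nat) (p : 'rV[R]_n -> R)
    (u : 'rV[R]_N -> 'rV[R]_n) :
  (forall i, is_polynomial (fun z => u z 0 i)) ->
  is_polynomial p -> is_polynomial (fun z => p (u z)).
Proof.
move=> hu; move: p; apply: is_polynomial_ind => //.
- by move=> p q pq; apply: is_polynomial_ext => z; rewrite pq.
- exact: is_polynomial_cst.
- by move=> p q _ _; exact: is_polynomialD.
- by move=> p q _ _; exact: is_polynomialM.
Qed.

(** Young's inequality in the form of an identity, so that the square it discards is available as an
    SOS term. *)
Lemma sqr_young (R : realType) (c d x y : R) : d != 0 ->
  (4 * d)^-1 * (2 * d * x + c * y) ^+ 2
  = d * x ^+ 2 + c * (x * y) + c ^+ 2 / (4 * d) * y ^+ 2.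
Proof. by move=> d0; field. Qed.

Section sos_domination.
Variables (R : realType) (n N : nat) (h v : 'I_n -> 'rV[R]_N -> R).
Hypothesis hP : forall i, is_polynomial (h i).
Hypothesis vP : forall i, is_polynomial (v i).

Let s z := \sum_(i < n) h i z ^+ 2.
Let w z := \sum_(i < n) v i z ^+ 2.

Let sos_s : is_sos s.
Proof. by apply: is_sos_sum => i; exact: is_sos_sqr. Qed.

Let sos_w : is_sos w.
Proof. by apply: is_sos_sum => i; exact: is_sos_sqr. Qed.

Let sosX k : is_sos (fun z => s z ^+ k).
Proof. exact: is_sosX. Qed.

Let poly_s : is_polynomial s.
Proof. by apply: is_polynomial_sum => i; exact: is_polynomialX. Qed.

Lemma pow_le_pow_succ i e : (0 < i)%N -> 0 < e ->
  exists2 C, 0 <= C & is_sos (fun z => e + C * s z ^+ i.+1 - s z ^+ i).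
Proof.
have dom d k : 0 < d -> is_sos (fun z => s z ^+ k * (s z - 2 * d) ^+ 2).
  move=> d0; apply: is_sosM => //; apply: is_sos_sqr.
  by apply: is_polynomialB => //; exact: is_polynomial_cst.
case: i => // i _; elim: i e => [|i IH] e e0.
  exists (4 * e)^-1; first by rewrite invr_ge0; lra.
  apply: is_sos_ext (is_sosZ (_ : 0 <= (4 * e)^-1) (dom e 0%N e0)) => [z|].
    by rewrite expr0 expr1; field; lra.
  by rewrite invr_ge0; lra.
have [C C0 HC] := IH 1 ltr01.
have C1 : 0 < 1 + e * C by rewrite ltr_pwDl // mulr_ge0 // ltW.
(* Chosen so that d (1 + e C) = e. Then e times the induction hypothesis at 1, plus a multiple of
   s^(i+1) (s - 2d)^2, loses its terms in s^(i+1), and s^(i+2) is left with coefficient -1. *)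
pose d := e / (1 + e * C).
have d0 : 0 < d by rewrite divr_gt0.
exists ((1 + e * C) ^+ 2 / (4 * e)).
  by rewrite divr_ge0 ?sqr_ge0 // mulr_ge0 // ltW.
have k0 : 0 <= (1 + e * C) / (4 * d).
  by apply: divr_ge0; [exact: ltW|apply: mulr_ge0 => //; exact: ltW].
apply: is_sos_ext (is_sosD (is_sosZ (ltW e0) HC) (is_sosZ k0 (dom d i.+1 d0))).
move=> z; rewrite !exprS; move: (s z ^+ i) => m; rewrite /d.
by field; rewrite !lt0r_neq0.
Qed.

Lemma pow_le_pow g a e : (0 < g)%N -> (g <= a)%N -> 0 < e ->
  exists2 C, 0 <= C & is_sos (fun z => e + C * s z ^+ a - s z ^+ g).
Proof.
move=> g0; elim: a e => [|a IH] e; first by case: g g0.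
rewrite leq_eqVlt => /predU1P[<-|ga] e0.
  exists 1; first exact: ler01.
  by apply: is_sos_ext (is_sos_cst _ (ltW e0)) => z; rewrite mul1r addrK.
have e2 : 0 < e / 2 by rewrite divr_gt0.
have [C C0 HC] := IH (e / 2) ga e2.
(* The tolerance is divided by C + 1 because this inequality is about to be multiplied by C, which
   must cost at most e/2. *)
have [|C' C'0 HC'] := @pow_le_pow_succ a (e / 2 / (C + 1)) (leq_trans g0 ga).
  by rewrite divr_gt0 // ltr_wpDl.
exists (C * C'); first exact: mulr_ge0.
have r0 : 0 <= e / 2 - C * (e / 2 / (C + 1)).
  have -> : e / 2 - C * (e / 2 / (C + 1)) = e / 2 / (C + 1) by field; lra.
  by rewrite divr_ge0 ?ltW // ltr_wpDl.
apply: is_sos_ext (is_sosD (is_sosD HC (is_sosZ C0 HC')) (is_sos_cst _ r0)) => z.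
by rewrite /=; field; lra.
Qed.

Lemma pow_le_one_add_pow b a : (b <= a)%N ->
  exists2 C, 0 <= C & is_sos (fun z => 1 + C * s z ^+ a - s z ^+ b).
Proof.
case: b => [|b] ba; last exact: pow_le_pow.
by exists 0 => //; apply: is_sos_ext (is_sos0 _ _) => z; rewrite mul0r addr0 subrr.
Qed.

Let mono (t : seq 'I_n) z := \prod_(i <- t) h i z.

Let poly_mono t : is_polynomial (mono t).
Proof. exact: is_polynomial_prod. Qed.

Lemma sqr_le_sum_sqr (u : 'I_n -> 'rV[R]_N -> R) i :
  (forall i, is_polynomial (u i)) ->
  is_sos (fun z => \sum_(j < n) u j z ^+ 2 - u i z ^+ 2).
Proof.
move=> uP; apply: (@is_sos_ext _ _ _
    (fun z => \sum_(j <- [seq j <- index_enum 'I_n | j != i]) u j z ^+ 2)).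
  by move=> z; rewrite (bigD1 i) //= big_filter addrAC subrr add0r.
by apply: is_sos_sum => j; exact: is_sos_sqr.
Qed.

(** Adding the letter i to the monomial m uses s^(k+1) - (h_i m)^2 = s (s^k - m^2) + m^2 (s -
    h_i^2). *)
Lemma sqr_mono_le t : is_sos (fun z => s z ^+ size t - mono t z ^+ 2).
Proof.
elim: t => [|i t IH].
  by apply: is_sos_ext (is_sos0 _ _) => z; rewrite /mono big_nil expr1n subrr.
apply: is_sos_ext (is_sosD (is_sosM sos_s IH)
  (is_sosM (is_sos_sqr (poly_mono t)) (sqr_le_sum_sqr i hP))) => z.
by rewrite /mono big_cons /= -/(s z) exprS; ring.
Qed.

Lemma sqr_mono_mul_le t i :
  is_sos (fun z => s z ^+ size t * w z - (mono t z * v i z) ^+ 2).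
Proof.
apply: is_sos_ext (is_sosD (is_sosM (sqr_mono_le t) sos_w)
  (is_sosM (is_sos_sqr (poly_mono t)) (sqr_le_sum_sqr i vP))) => z.
by rewrite -/(w z); ring.
Qed.

(** A family [F] of forms is dominated with one constant C for all its members. This uniformity is
    what later turns a bound on the derivatives of f into a bound on t(x). *)
Definition sos_dominated (a : nat) (F : set ('rV[R]_N -> R)) :=
  forall e, 0 < e -> exists2 C, 0 <= C &
    forall p, F p -> is_sos (fun z => e * w z + C * (s z ^+ a * w z) + p z).

Lemma sos_dominatedS a F G : F `<=` G -> sos_dominated a G -> sos_dominated a F.
Proof.
by move=> FG HG e e0; have [C C0 HC] := HG e e0; exists C => // p /FG /HC.
Qed.

Lemma sos_dominatedD a F G : sos_dominated a F -> sos_dominated a G ->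
  sos_dominated a [set p | exists q r, [/\ F q, G r & forall z, p z = q z + r z]].
Proof.
move=> HF HG e e0; have e2 : 0 < e / 2 by rewrite divr_gt0.
have [C C0 HC] := HF _ e2; have [D D0 HD] := HG _ e2.
exists (C + D) => [|p [q [r [Fq Gr pE]]]]; first exact: addr_ge0.
apply: is_sos_ext (is_sosD (HC _ Fq) (HD _ Gr)) => z.
by rewrite pE /=; field.
Qed.

Lemma sos_dominated_sum a (I : Type) (r : seq I) (F : I -> set ('rV[R]_N -> R)) :
  (forall i, sos_dominated a (F i)) ->
  sos_dominated a [set p | exists q : I -> 'rV[R]_N -> R,
    (forall i, F i (q i)) /\ forall z, p z = \sum_(i <- r) q i z].
Proof.
move=> HF; elim: r => [|i r IH].
  move=> e e0; exists 0 => // p [q [_ pE]].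
  apply: is_sos_ext (is_sosZ (ltW e0) sos_w) => z.
  by rewrite pE big_nil mul0r !addr0.
apply: sos_dominatedS (sos_dominatedD (HF i) IH) => p [q [Fq pE]].
exists (q i), (fun z => \sum_(j <- r) q j z); split => //; first by exists q.
by move=> z; rewrite pE big_cons.
Qed.

(* The monomial is split into halves of degree at most [a], and Young's
   inequality is applied to the two halves. *)
Lemma sos_dominated_mono a K (t : seq 'I_n) i j : 0 <= K ->
  (0 < size t < a.*2)%N ->
  sos_dominated a [set p | exists2 c : R, `|c| <= K &
    forall z, p z = c * (mono t z * (v i z * v j z))].
Proof.
move=> K0 /andP[t0 ta] e e0.
pose b := (size t)./2; pose t1 := take b t; pose t2 := drop b t.
have bt : (b <= size t)%N by rewrite /b; lia.
have st1 : size t1 = b by rewrite size_takel.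
have st2 : size t2 = (size t - b)%N by rewrite size_drop.
have ba : (b <= a)%N by rewrite /b; lia.
(* The half [t1] may be empty, so its power of [s] is bounded by 1 + C1 s^a; [t2] is never empty, so
   its power is bounded with an arbitrarily small constant term. *)
have g0 : (0 < size t2)%N by rewrite st2 /b; lia.
have ga : (size t2 <= a)%N by rewrite st2 /b; lia.
have tE z : mono t z = mono t1 z * mono t2 z.
  by rewrite /mono -big_cat cat_take_drop.
have [C1 C10 H1] := pow_le_one_add_pow ba.
(* Young's inequality with weight e/2 on [x] puts at most K^2/(2e) on [y]; this [eta] keeps K^2/(2e)
   eta below the other e/2. *)
pose eta := e ^+ 2 / (K ^+ 2 + 1).
have K1 : 0 < K ^+ 2 + 1 by rewrite ltr_wpDl // sqr_ge0.
have eta0 : 0 < eta by rewrite divr_gt0 // exprn_gt0.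
have [C2 C20 H2] := pow_le_pow g0 ga eta0.
have d0 : 0 < e / 2 by rewrite divr_gt0.
have k0 : 0 <= K ^+ 2 / (4 * (e / 2)) by rewrite divr_ge0 ?sqr_ge0 ?mulr_ge0 // ltW.
have r0 : 0 <= e - e / 2 - K ^+ 2 / (4 * (e / 2)) * eta.
  have -> : e - e / 2 - K ^+ 2 / (4 * (e / 2)) * eta = e / 2 / (K ^+ 2 + 1).
    by rewrite /eta; field; rewrite !lt0r_neq0.
  by rewrite divr_ge0 ?ltW.
exists (e / 2 * C1 + K ^+ 2 / (4 * (e / 2)) * C2) => [|p [c cK pE]].
  by apply: addr_ge0; apply: mulr_ge0 => //; exact: ltW.
have c0 : 0 <= (K ^+ 2 - c ^+ 2) / (4 * (e / 2)).
  apply: divr_ge0; last by apply: mulr_ge0 => //; exact: ltW.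
  by rewrite subr_ge0 -(real_normK (num_real c)) ler_sqr ?nnegrE.
have y0 : 0 <= (4 * (e / 2))^-1 by rewrite invr_ge0 mulr_ge0 // ltW.
pose x z := mono t1 z * v i z; pose y z := mono t2 z * v j z.
have xP : is_polynomial x by exact: is_polynomialM.
have yP : is_polynomial y by exact: is_polynomialM.
have X1 : is_sos (fun z => (1 + C1 * s z ^+ a) * w z - x z ^+ 2).
  apply: is_sos_ext (is_sosD (is_sosM H1 sos_w) (sqr_mono_mul_le t1 i)) => z.
  by rewrite st1 /x /=; ring.
have Y1 : is_sos (fun z => (eta + C2 * s z ^+ a) * w z - y z ^+ 2).
  apply: is_sos_ext (is_sosD (is_sosM H2 sos_w) (sqr_mono_mul_le t2 j)) => z.
  by rewrite /y /=; ring.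
have S : is_sos (fun z => (4 * (e / 2))^-1 * (2 * (e / 2) * x z + c * y z) ^+ 2).
  apply: is_sosZ => //; apply: is_sos_sqr.
  by apply: is_polynomialD; exact: is_polynomialZ.
apply: is_sos_ext (is_sosD S (is_sosD (is_sosD (is_sosZ (ltW d0) X1) (is_sosZ k0 Y1))
  (is_sosD (is_sosZ c0 (is_sos_sqr yP)) (is_sosZ r0 sos_w)))) => z.
rewrite pE tE /= sqr_young ?lt0r_neq0 //.
have -> : mono t1 z * mono t2 z * (v i z * v j z) = x z * y z.
  by rewrite /x /y; ring.
rewrite (mulrBl _ (K ^+ 2)); set k := (4 * (e / 2))^-1; ring.
Qed.

End sos_domination.

(** * Directional derivatives *)

Section euclidean_norm.
Variables (R : realType) (n : nat).
Implicit Types u v w : 'rV[R]_n.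

Lemma enorm_ge0 v : 0 <= enorm v.
Proof. exact: sqrtr_ge0. Qed.

Lemma enorm_sqr v : enorm v ^+ 2 = \sum_(i < n) v 0 i ^+ 2.
Proof. by rewrite sqr_sqrtr // sumr_ge0 // => i _; rewrite sqr_ge0. Qed.

Lemma enorm_gt0 v : v != 0 -> 0 < enorm v.
Proof.
move=> v0; rewrite lt_def enorm_ge0 andbT; apply: contra v0 => /eqP e.
have /eqP := enorm_sqr v; rewrite e expr0n /= eq_sym psumr_eq0; last first.
  by move=> i _; rewrite sqr_ge0.
move=> /allP H; apply/eqP/rowP => i; rewrite mxE; apply/eqP.
by rewrite -sqrf_eq0; apply: H; rewrite mem_index_enum.
Qed.

Lemma enormZ a v : enorm (a *: v) = `|a| * enorm v.
Proof.
rewrite /enorm -sqrtr_sqr -sqrtrM ?sqr_ge0 // mulr_sumr; congr Num.sqrt.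
by apply: eq_bigr => i _; rewrite mxE exprMn.
Qed.

Lemma enorm0 : enorm (0 : 'rV[R]_n) = 0.
Proof. by rewrite -(scale0r (0 : 'rV[R]_n)) enormZ normr0 mul0r. Qed.

Lemma enormN v : enorm (- v) = enorm v.
Proof. by rewrite -scaleN1r enormZ normrN1 mul1r. Qed.

Lemma enorm_distC u v : enorm (u - v) = enorm (v - u).
Proof. by rewrite -opprB enormN. Qed.

Lemma coord_le_enorm v i : `|v 0 i| <= enorm v.
Proof.
rewrite -ler_sqr ?nnegrE ?enorm_ge0 // real_normK ?num_real // enorm_sqr.
by rewrite (bigD1 i) //= lerDl sumr_ge0 // => j _; rewrite sqr_ge0.
Qed.

Lemma norm_le_enorm v : `|v| <= enorm v.
Proof.
rewrite [leLHS]/Num.norm /= mx_normrE; apply/bigmax_leP; split; first exact: enorm_ge0.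
by move=> [i j] _ /=; rewrite (ord1 i) coord_le_enorm.
Qed.

Lemma cauchy_schwarz u v : `|\sum_(i < n) u 0 i * v 0 i| <= enorm u * enorm v.
Proof.
have [->|v0] := eqVneq v 0.
  by rewrite enorm0 mulr0 big1 ?normr0 // => i _; rewrite mxE mulr0.
set S := \sum_i _.
have v2 : 0 < enorm v ^+ 2 by rewrite exprn_gt0 // enorm_gt0.
rewrite -ler_sqr ?nnegrE ?mulr_ge0 ?enorm_ge0 // real_normK ?num_real // exprMn.
have : 0 <= \sum_(i < n) (enorm v ^+ 2 * u 0 i - S * v 0 i) ^+ 2.
  by apply: sumr_ge0 => i _; rewrite sqr_ge0.
have -> : \sum_(i < n) (enorm v ^+ 2 * u 0 i - S * v 0 i) ^+ 2 =
    \sum_(i < n) (enorm v ^+ 4 * u 0 i ^+ 2 +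
       (- 2 * enorm v ^+ 2 * S * (u 0 i * v 0 i) + S ^+ 2 * v 0 i ^+ 2)).
  by apply: eq_bigr => i _; ring.
rewrite !big_split /= -!mulr_sumr -!enorm_sqr -/S => H.
rewrite -subr_ge0 -(pmulr_lge0 _ v2).
by move: H; congr (0 <= _); ring.
Qed.

End euclidean_norm.

Section directional_derivatives.
Variables (R : realType) (n : nat).
Implicit Types (g : 'rV[R]_n -> R) (x u v w : 'rV[R]_n).

Lemma is_deriveP (V : normedModType R) (g : V -> R) (x v : V) (l : R) :
  is_derive x v g l <->
  (fun t : R => t^-1 * (g (t *: v + x) - g x)) @ 0^' --> l.
Proof.
split=> [H|H].
  by have /cvgP := @ex_derive _ _ _ _ _ _ _ H; rewrite -(@derive_val _ _ _ _ _ _ _ H).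
apply: DeriveDef; first by apply/cvg_ex; exists l.
exact: cvg_lim H.
Qed.

Lemma is_derive_line g x v (s l : R) : is_derive (x + s *: v) v g l ->
  is_derive s (1 : R) (fun t : R => g (x + t *: v)) l.
Proof.
move=> /is_deriveP H.
apply/is_deriveP.
rewrite (_ : (fun t => _) = (fun t : R => t^-1 * (g (t *: v + (x + s *: v)) - g (x + s *: v)))) //.
apply/funext => t /=; have -> : t *: (1 : R) = t by rewrite [LHS]mulr1.
by rewrite scalerDl addrCA.
Qed.

Lemma mvt_line g (gv : 'rV[R]_n -> R) x v (t : R) :
  (forall y, is_derive y v g (gv y)) ->
  exists2 c, `|c| <= `|t| & g (x + t *: v) - g x = gv (x + c *: v) * t.
Proof.
move=> H; have D s := is_derive_line (H (x + s *: v)).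
have [t0|t0] := leP 0 t.
  have [c /andP[c0 ct] e] := mvt_derive D t0.
  exists c; first by rewrite !ger0_norm.
  by move: e; rewrite scale0r addr0 subr0.
have [c /andP[tc c0] e] := mvt_derive D (ltW t0).
exists c; first by rewrite !ler0_norm ?lerN2 // ltW.
by apply: oppr_inj; move: e; rewrite scale0r addr0 sub0r mulrN opprB.
Qed.

Lemma continuous_plane g x u v e : {for x, continuous g} -> 0 < e ->
  exists2 r : R, 0 < r & forall a b : R, `|a| <= r -> `|b| <= r ->
    `|g (x + a *: u + b *: v) - g x| < e.
Proof.
move=> /cvgrPdist_lt/(_ e) gx e0; have /nbhs_ballP[r /= r0 H] := gx e0.
have M0 : 0 < `|u| + `|v| + 1 by rewrite ltr_wpDl // addr_ge0.
exists (r / 2 / (`|u| + `|v| + 1)) => [|a b ha hb].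
  by rewrite !divr_gt0.
rewrite distrC; apply: H; rewrite -ball_normE /= opprD opprD addrA addrA subrr sub0r.
rewrite -opprD normrN (le_lt_trans (ler_normD _ _)) // !normrZ.
apply: (@le_lt_trans _ _ (r / 2)); last by rewrite ltr_pdivrMr // mulr2n mulrDr mulr1 ltrDl.
have -> : r / 2 = r / 2 / (`|u| + `|v| + 1) * (`|u| + `|v| + 1).
  by rewrite divfK // gt_eqF.
rewrite mulrDr mulrDr -addrA lerD ?ler_wpM2r // ler_wpDr ?ler_wpM2r //.
by rewrite mulr1 !divr_ge0 // ltW.
Qed.

(** The increment is split into a move along [w] and then a move along [v] from the displaced point,
    the latter being rewritten by the mean value theorem. Along [w] differentiability is asked at
    [x] alone, which lets basis directions be added one after the other. *)
Lemma is_derive_add_dir g (gv : 'rV[R]_n -> R) x w v (a l : R) :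
  is_derive x w g l -> (forall y, is_derive y v g (gv y)) ->
  {for x, continuous gv} -> is_derive x (w + a *: v) g (l + a * gv x).
Proof.
move=> /is_deriveP gw Hv cv; apply/is_deriveP.
have E : (fun t : R => t^-1 * (g (t *: (w + a *: v) + x) - g x)) =
    (fun t : R => t^-1 * (g (t *: w + x) - g x) +
       t^-1 * (g (x + t *: w + (t * a) *: v) - g (x + t *: w))).
  apply/funext => t; rewrite -mulrDr [in RHS]addrC [t *: w + x]addrC subrKA.
  by rewrite scalerDr scalerA [_ + x]addrC addrA.
rewrite E; apply: cvgD => //; apply/cvgrPdist_le => e e0.
pose e' := e / (`|a| + 1).
have a1 : 0 < `|a| + 1 by rewrite ltr_wpDl.
have e'0 : 0 < e' by rewrite divr_gt0.
have [r r0 Hr] := continuous_plane w v cv e'0.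
exists (r / (`|a| + 1)); first by rewrite /= divr_gt0.
move=> t /=; rewrite sub0r normrN => tr t0.
have [c ct ->] := mvt_line (x + t *: w) (t * a) Hv.
rewrite (mulrCA t^-1) (mulrA t^-1) mulVf // mul1r mulrC -mulrBl normrM distrC.
have lt1 : `|t| * `|a| <= r.
  apply: (@le_trans _ _ (r / (`|a| + 1) * (`|a| + 1))); last by rewrite divfK ?gt_eqF.
  by rewrite ler_pM // ?ltW // ltrDl.
have lt2 : `|t| <= r.
  rewrite (le_trans (ltW tr)) // ler_pdivrMr // mulrDr mulr1 lerDr mulr_ge0 //.
  exact: ltW.
rewrite -normrM in lt1; have /ltW H := Hr t c lt2 (le_trans ct lt1).
rewrite mulrC (le_trans (ler_wpM2l _ H)) // /e' mulrA ler_pdivrMr // mulrC.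
by rewrite ler_wpM2l ?ltW // ltrDl.
Qed.

Lemma is_derive_partials g (dg : 'I_n -> 'rV[R]_n -> R) x v :
  (forall i y, is_derive y (delta_mx 0 i) g (dg i y)) ->
  (forall i, continuous (dg i)) ->
  is_derive x v g (\sum_(i < n) v 0 i * dg i x).
Proof.
move=> H C; rewrite {1}(row_sum_delta v).
elim: (index_enum 'I_n) => [|i r IH].
  by rewrite !big_nil; exact: is_derive0.
rewrite !big_cons addrC [X in is_derive _ _ _ X]addrC.
by apply: is_derive_add_dir => //; exact: C.
Qed.

(** Schwarz's theorem: the second difference of [g] over a small parallelogram, evaluated by two
    mean values in either order, gives values of [guv] and [gvu] at points near [x]. *)
Lemma derive_comm g (gu gv guv gvu : 'rV[R]_n -> R) u v x :
  (forall y, is_derive y u g (gu y)) -> (forall y, is_derive y v g (gv y)) ->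
  (forall y, is_derive y v gu (guv y)) -> (forall y, is_derive y u gv (gvu y)) ->
  {for x, continuous guv} -> {for x, continuous gvu} -> guv x = gvu x.
Proof.
move=> Hu Hv Huv Hvu Cuv Cvu; apply/eqP; rewrite -subr_eq0 -normr_le0.
apply/ler_addgt0Pl => e e0; rewrite addr0.
have e2 : 0 < e / 2 by rewrite divr_gt0.
have [r1 r10 H1] := continuous_plane u v Cuv e2.
have [r2 r20 H2] := continuous_plane v u Cvu e2.
pose t := Num.min r1 r2.
have t0 : 0 < t by rewrite lt_min r10 r20.
have [t1 t2] : t <= r1 /\ t <= r2 by rewrite ge_min lexx ge_min lexx orbT.
have second (a b : 'rV[R]_n) (ga gab : 'rV[R]_n -> R) :
    (forall y, is_derive y a g (ga y)) -> (forall y, is_derive y b ga (gab y)) ->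
    exists c1 c2 : R, [/\ `|c1| <= t, `|c2| <= t &
      (g (x + t *: b + t *: a) - g (x + t *: a)) - (g (x + t *: b) - g x) =
      gab (x + c1 *: a + c2 *: b) * (t * t)].
  move=> Ha Hab.
  have D s : is_derive s (1 : R) (fun s => g (x + t *: b + s *: a) - g (x + s *: a))
      (ga (x + t *: b + s *: a) - ga (x + s *: a)).
    by apply: is_deriveB; exact: is_derive_line.
  have [c1 /andP[c10 c1t] e1] := mvt_derive D (ltW t0).
  have [c2 c2t e2'] := mvt_line (x + c1 *: a) t Hab.
  exists c1, c2; split; first by rewrite ger0_norm.
    by rewrite (le_trans c2t) // ger0_norm // ltW.
  move: e1; rewrite !scale0r !addr0 subr0 => ->.
  by rewrite addrAC e2' mulrA.
have [c1 [c2 [h1 h2 e1]]] := second u v gu guv Hu Huv.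
have [c3 [c4 [h3 h4 e3]]] := second v u gv gvu Hv Hvu.
have tt : t * t != 0 by rewrite mulf_neq0 // gt_eqF.
have E : guv (x + c1 *: u + c2 *: v) = gvu (x + c3 *: v + c4 *: u).
  apply: (mulIf tt); rewrite -e1 -e3 (addrAC x (t *: v)).
  by move: (g _) (g _) (g _) (g _) => p q r s; ring.
have /ltW K1 := H1 _ _ (le_trans h1 t1) (le_trans h2 t1).
have /ltW K2 := H2 _ _ (le_trans h3 t2) (le_trans h4 t2).
rewrite -(subrKA (guv (x + c1 *: u + c2 *: v))) (le_trans (ler_normD _ _)) //.
by rewrite [leRHS](splitr e); apply: lerD; [rewrite distrC|rewrite E].
Qed.

End directional_derivatives.

(** First-order condition at an endpoint: [e] is the direction pointing into the segment, 1 at its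
    left end and -1 at its right end. *)
Lemma derive_ge0_at_min (R : realType) (phi : R -> R) (s e l : R) :
  is_derive s (1 : R) phi l ->
  (forall t, 0 < t <= 1 -> phi s <= phi (s + t * e)) -> 0 <= e * l.
Proof.
move=> D H; rewrite leNgt; apply/negP => el.
have l0 : 0 < `|l| by rewrite normr_gt0; apply: contraTneq el => ->; rewrite mulr0 ltxx.
have e0 : e != 0 by apply: contraTneq el => ->; rewrite mul0r ltxx.
move/is_deriveP: D => /cvgrPdist_lt/(_ _ l0)[r /= r0 Hr].
pose t := Num.min 1 (r / 2 / `|e|).
have e1 : 0 < `|e| by rewrite normr_gt0.
have t0 : 0 < t by rewrite lt_min ltr01 !divr_gt0.
have t1 : t <= 1 by rewrite ge_min lexx.
have te0 : t * e != 0 by rewrite mulf_neq0 // gt_eqF.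
have := Hr (t * e) _ te0; rewrite /= sub0r normrN normrM (gtr0_norm t0) => /(_ _)/wrap[|].
  apply: (@le_lt_trans _ _ (r / 2)); last by lra.
  by rewrite -ler_pdivlMr // ge_min lexx orbT.
have -> : (t * e) *: (1 : R) = t * e by rewrite [LHS]mulr1.
rewrite (addrC (t * e)).
have : phi s <= phi (s + t * e) by apply: H; rewrite t0.
set a := phi (s + t * e); set b := phi s => ab lt.
have K : 0 <= e * ((t * e)^-1 * (a - b)).
  rewrite invfM mulrA mulrCA mulfV // mulr1.
  by apply: mulr_ge0; [rewrite invr_ge0 ltW|rewrite subr_ge0].
move: lt K el; set q := _^-1 * _ => lt K el.
case: (ltrgtP e 0) e0 => // e0 _.
  move: lt K el; rewrite nmulr_rge0 // nmulr_rlt0 // => lt K el.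
  by move: lt; rewrite (gtr0_norm el) ger0_norm ?subr_ge0; lra.
move: lt K el; rewrite pmulr_rge0 // pmulr_rlt0 // => lt K el.
by move: lt; rewrite (ltr0_norm el) ler0_norm ?subr_le0; lra.
Qed.

(** * Multilinear forms and Taylor estimates *)

Section multilinear_forms.
Variables (R : realType) (n : nat).
Implicit Types (c : seq 'I_n -> R) (us : seq 'rV[R]_n) (t : seq 'I_n).
Implicit Types (h u v w : 'rV[R]_n).

(* The tensor with coordinates [c], its first [size t] slots being filled with
   the basis vectors listed in [t] and the following ones with [us]. *)
Fixpoint mform c us t : R :=
  if us is u :: us' then \sum_(i < n) u 0 i * mform c us' (rcons t i) else c t.

(** Symmetry is limited to length [d] because a function of class C^d has partial derivatives only
    up to that order. *)
Definition perm_invariant (d : nat) c :=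
  forall t t', perm_eq t t' -> (size t <= d)%N -> c t = c t'.

Lemma mformB c c' us t :
  mform (fun s => c s - c' s) us t = mform c us t - mform c' us t.
Proof.
elim: us t => [//|u us IH] t /=; rewrite -sumrB.
by apply: eq_bigr => i _; rewrite IH mulrBr.
Qed.

Lemma mform_perm d c us t t' : perm_invariant d c -> perm_eq t t' ->
  (size us + size t <= d)%N -> mform c us t = mform c us t'.
Proof.
move=> cP; elim: us t t' => [|u us IH] t t' tt' /= sd; first exact: (cP t t').
apply: eq_bigr => i _; congr (_ * _); apply: IH.
  by rewrite -!cats1 perm_cat2r.
by rewrite size_rcons addnS.
Qed.

Lemma mform_swap d c u v us t : perm_invariant d c ->
  ((size us).+2 + size t <= d)%N -> mform c (u :: v :: us) t = mform c (v :: u :: us) t.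
Proof.
move=> cP sd /=.
under eq_bigr do rewrite mulr_sumr.
rewrite exchange_big; apply: eq_bigr => i _; rewrite mulr_sumr.
apply: eq_bigr => j _; rewrite mulrCA; congr (_ * (_ * _)).
apply: (mform_perm cP); last by rewrite !size_rcons !addnS -!addSn.
by rewrite -!cats1 -!catA perm_cat2l /= (perm_catC [:: j] [:: i]).
Qed.

Lemma mform_nseq_cat d c k h w us t : perm_invariant d c ->
  (k + (size us).+1 + size t <= d)%N ->
  mform c (nseq k h ++ w :: us) t = mform c (w :: nseq k h ++ us) t.
Proof.
move=> cP; elim: k t => [//|k IH] t sd.
rewrite -[RHS](mform_swap (d := d) h w (us := nseq k h ++ us)) //; last first.
  by rewrite size_cat size_nseq; lia.
rewrite [LHS]/= [RHS]/=; apply: eq_bigr => i _; congr (_ * _).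
by rewrite IH // size_rcons; lia.
Qed.

Lemma is_derive_fsum (N : nat) (F : 'I_N -> 'rV[R]_n -> R) (dF : 'I_N -> R)
    (x v : 'rV[R]_n) :
  (forall i, is_derive x v (F i) (dF i)) ->
  is_derive x v (fun y => \sum_(i < N) F i y) (\sum_(i < N) dF i).
Proof.
move=> H; rewrite (_ : (fun y => _) = \sum_(i < N) F i); first exact: is_derive_sum.
by apply/funext => y; rewrite fct_sumE.
Qed.

Lemma is_derive_mul (F G : 'rV[R]_n -> R) (x v : 'rV[R]_n) (dF dG : R) :
  is_derive x v F dF -> is_derive x v G dG ->
  is_derive x v (fun y => F y * G y) (F x * dG + G x * dF).
Proof. by move=> HF HG; exact: is_deriveM. Qed.

Lemma is_derive_coord h w i : is_derive h w (fun x : 'rV[R]_n => x 0 i) (w 0 i).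
Proof.
apply/is_deriveP; apply: cvg_near_cst; exists 1 => //= t _ t0.
by rewrite !mxE addrK mulKf.
Qed.

(** The product rule yields one term per slot holding [x]; by symmetry [w] can be moved to the
    front, which makes the k terms equal. For k = 0 the factor [k%:R] cancels the value in which
    [k.-1] is truncated. *)
Lemma is_derive_mform_nseq d c k h w us t : perm_invariant d c ->
  (k + size us + size t <= d)%N ->
  is_derive h w (fun x => mform c (nseq k x ++ us) t)
    (k%:R * mform c (w :: nseq k.-1 h ++ us) t).
Proof.
move=> cP; elim: k t => [|k IH] t sd.
  by rewrite mul0r; exact: is_derive_cst.
rewrite (_ : k.+1%:R * _ = \sum_(i < n) (h 0 i * (k%:R * mform c (w :: nseq k.-1 h ++ us) (rcons t i))
   + mform c (nseq k h ++ us) (rcons t i) * w 0 i)).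
  apply: is_derive_fsum => i.
  apply: (@is_derive_mul (fun x => x 0 i) (fun x => mform c (nseq k x ++ us) (rcons t i))).
    exact: is_derive_coord.
  by apply: IH; rewrite size_rcons; lia.
rewrite big_split /= -natr1 mulrDl mul1r; congr (_ + _).
  case: k sd {IH} => [|k] sd.
    by rewrite mul0r big1 // => i _; rewrite mul0r mulr0.
  transitivity (k.+1%:R * mform c (h :: w :: nseq k h ++ us) t).
    congr (_ * _); apply: (mform_swap (us := nseq k h ++ us) w h cP).
    by rewrite size_cat size_nseq; lia.
  by rewrite mulr_sumr; apply: eq_bigr => i _; rewrite mulrCA.
by apply: eq_bigr => i _; rewrite mulrC.
Qed.

Lemma mform_tuple k c (us : k.-tuple 'rV[R]_n) t :
  mform c us t =
  \sum_(s : k.-tuple 'I_n) c (t ++ s) * \prod_(j < k) tnth us j 0 (tnth s j).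
Proof.
elim: k us t => [|k IH] us t.
  rewrite tuple0 /= (bigD1 [tuple]) //= [X in _ + X]big1 => [|s].
    by rewrite big_ord0 mulr1 cats0 addr0.
  by rewrite (tuple0 s).
case: (tupleP us) => u us' /=.
under eq_bigr do rewrite IH mulr_sumr.
rewrite pair_big /=.
rewrite [RHS](reindex (fun p : 'I_n * k.-tuple 'I_n => [tuple of p.1 :: p.2])) /=.
  apply: eq_bigr => -[i s] _ /=; rewrite cat_rcons mulrCA; congr (_ * _).
  rewrite big_ord_recl !tnth0; congr (_ * _).
  by apply: eq_bigr => j _; rewrite !tnthS.
exists (fun s => (thead s, [tuple of behead s])) => [[i s] _|s _] /=.
  by congr pair; apply: val_inj.
by rewrite [RHS]tuple_eta.
Qed.

Lemma mform_nseq k c h t :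
  mform c (nseq k h) t =
  \sum_(s : k.-tuple 'I_n) c (t ++ s) * \prod_(i <- s) h 0 i.
Proof.
rewrite (mform_tuple c (nseq_tuple k h)); apply: eq_bigr => s _; congr (_ * _).
rewrite big_tuple; apply: eq_bigr => j _.
by rewrite (tnth_nth 0) nth_nseq ltn_ord.
Qed.

Lemma tensor_app_mform k c (u : 'I_k -> 'rV[R]_n) :
  tensor_app [ffun s : k.-tuple 'I_n => c (s : seq 'I_n)] u = mform c (mktuple u) [::].
Proof.
rewrite mform_tuple; apply: eq_bigr => s _; rewrite ffunE; congr (_ * _).
by apply: eq_bigr => j _; rewrite tnth_mktuple.
Qed.

Lemma tensor_norm_le k (A : tensor R n k) (u : 'I_k -> 'rV[R]_n) :
  `|tensor_app A u| <= tensor_norm A * \prod_(j < k) enorm (u j).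
Proof.
have [/existsP[j /eqP uj]|/existsPn u0] := boolP [exists j, u j == 0].
  rewrite [X in `|X|](_ : _ = 0).
    by rewrite normr0 [X in _ * X](bigD1 j) //= uj enorm0 mul0r mulr0.
  apply: big1 => s _.
  by rewrite [X in _ * X](bigD1 j) //= uj mxE mul0r mulr0.
have e0 j : 0 < enorm (u j) by rewrite enorm_gt0.
pose u' j := (enorm (u j))^-1 *: u j.
have -> : tensor_app A u = \prod_(j < k) enorm (u j) * tensor_app A u'.
  rewrite /tensor_app mulr_sumr; apply: eq_bigr => s _; rewrite mulrCA.
  rewrite -big_split; congr (_ * _); apply: eq_bigr => j _ /=.
  by rewrite mxE mulVKf // gt_eqF.
have p0 : 0 <= \prod_(j < k) enorm (u j).
  by apply: prodr_ge0 => j _; rewrite enorm_ge0.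
rewrite normrM ger0_norm // mulrC ler_wpM2r //.
apply: ub_le_sup; last first.
  exists u' => // j; rewrite enormZ ger0_norm ?invr_ge0 ?enorm_ge0 //.
  by rewrite mulVf // gt_eqF.
(* [sup] bounds the elements of a set only when the set is bounded; here coordinates of unit vectors
   are at most 1 in absolute value. *)
exists (\sum_(s : k.-tuple 'I_n) `|A s|) => _ [w w1 <-].
rewrite (le_trans (ler_norm_sum _ _ _)) // ler_sum // => s _.
rewrite normrM normr_prod ler_piMr //.
apply: prodr_ile1 => j _.
by rewrite normr_ge0 -(w1 j) coord_le_enorm.
Qed.

End multilinear_forms.

Section taylor_estimates.
Variables (R : realType) (n d : nat) (f : 'rV[R]_n -> R).
Hypothesis hf : continuously_differentiable d f.
Implicit Types (x y h u v w : 'rV[R]_n) (t : seq 'I_n) (us : seq 'rV[R]_n).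

Definition partials x t := ipartial t f x.

Lemma is_derive_ipartial t i x : (size t < d)%N ->
  is_derive x (delta_mx 0 i) (ipartial t f) (ipartial (i :: t) f x).
Proof. by move=> td; apply: derivableP; apply: hf.1. Qed.

Lemma is_derive_ipartial_dir t x h : (size t < d)%N ->
  is_derive x h (ipartial t f) (\sum_(i < n) h 0 i * ipartial (i :: t) f x).
Proof.
move=> td; apply: (is_derive_partials (dg := fun i => ipartial (i :: t) f)).
  by move=> i y; exact: is_derive_ipartial.
by move=> i; apply: hf.2.
Qed.

Lemma ipartial_swap t i j x : (size t + 2 <= d)%N ->
  ipartial (i :: j :: t) f x = ipartial (j :: i :: t) f x.
Proof.
move=> td; apply: (@derive_comm R n (ipartial t f)
  (ipartial (j :: t) f) (ipartial (i :: t) f) _ _ (delta_mx 0 j) (delta_mx 0 i)).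
- by move=> y; apply: is_derive_ipartial; lia.
- by move=> y; apply: is_derive_ipartial; lia.
- by move=> y; apply: is_derive_ipartial => /=; lia.
- by move=> y; apply: is_derive_ipartial => /=; lia.
- by apply: hf.2 => /=; lia.
- by apply: hf.2 => /=; lia.
Qed.

Lemma ipartial_perm t t' : perm_eq t t' -> (size t <= d)%N -> ipartial t f = ipartial t' f.
Proof.
(* An index in the middle can be brought to the front by swaps of the two outermost derivatives,
   since the outer ones act on functions already shown equal. *)
have front p i s : (size p + size s < d)%N -> ipartial (p ++ i :: s) f = ipartial (i :: p ++ s) f.
  elim: p => [//|j p IH] /= sd; apply/funext => x.
  rewrite -[RHS]/(ipartial (i :: j :: p ++ s) f x) ipartial_swap ?size_cat; last by lia.
  by rewrite /= -/(ipartial (p ++ i :: s) f) IH //; lia.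
elim: t t' => [|i t IH] t'; first by rewrite perm_sym => /perm_nilP ->.
move=> /[dup] /perm_mem/(_ i); rewrite mem_head => /esym/path.splitPr[p s].
rewrite -[X in perm_eq _ X]/(p ++ [:: i] ++ s) perm_sym perm_catCA perm_cons perm_sym => ts sd.
have sz := perm_size ts; rewrite size_cat in sz.
rewrite front; last by rewrite -sz.
by rewrite /= -/(ipartial t f) (IH _ ts) // ltnW.
Qed.

Lemma perm_invariant_partials x : perm_invariant d (partials x).
Proof. by move=> t t' tt' td; rewrite /partials (ipartial_perm tt'). Qed.

Lemma is_derive_mform_partials us t x h : (size us + size t < d)%N ->
  is_derive x h (fun y => mform (partials y) us t)
    (\sum_(i < n) h 0 i * mform (partials x) us (i :: t)).
Proof.
elim: us t => [|u us IH] t sd; first exact: is_derive_ipartial_dir.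
rewrite (_ : \sum_(i < n) _ = \sum_(i < n) u 0 i *
    (\sum_(j < n) h 0 j * mform (partials x) us (rcons (j :: t) i))); last first.
  under eq_bigr do rewrite /= mulr_sumr.
  rewrite exchange_big; apply: eq_bigr => i _; rewrite mulr_sumr.
  by apply: eq_bigr => j _; rewrite mulrCA.
apply: is_derive_fsum => i; apply: is_deriveZ; apply: IH.
by rewrite size_rcons; move: sd => /=; lia.
Qed.

Lemma taylorE x y : taylor d f x y =
  \sum_(k < d.+1) (k`!%:R)^-1 * mform (partials x) (nseq k (y - x)) [::].
Proof.
apply: eq_bigr => k _; congr (_ * _).
transitivity (mform (partials x) (mktuple (fun _ : 'I_k => y - x)) [::]).
  exact: tensor_app_mform.
congr mform.
apply: (@eq_from_nth _ 0) => [|j]; rewrite size_tuple ?size_nseq // => jk.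
by rewrite -[X in nth _ _ X]/(nat_of_ord (Ordinal jk)) -tnth_nth tnth_mktuple nth_nseq jk.
Qed.

Lemma quad_form_hessian x v : quad_form (hessian f x) v = mform (partials x) [:: v; v] [::].
Proof.
rewrite /quad_form mxE /=; under eq_bigr do rewrite mxE mulr_suml.
rewrite exchange_big; apply: eq_bigr => i _ /=; rewrite mulr_sumr.
by apply: eq_bigr => j _; rewrite !mxE -mulrA [X in _ * X]mulrC.
Qed.

Section lipschitz.
Variable L : R.
Hypothesis hlip : forall x y : 'rV[R]_n,
  tensor_norm (nabla d f y - nabla d f x) <= L * enorm (y - x).

Lemma mform_lipschitz us x y : size us = d ->
  `|mform (partials y) us [::] - mform (partials x) us [::]|
  <= L * enorm (y - x) * \prod_(u <- us) enorm u.
Proof.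
move=> /eqP sd; pose ut : d.-tuple 'rV[R]_n := Tuple sd.
rewrite -[us]/(val ut).
have -> : val ut = mktuple (tnth ut) by congr val; apply: eq_from_tnth => i; rewrite tnth_mktuple.
rewrite -mformB -tensor_app_mform big_tuple.
under [X in _ <= _ * X]eq_bigr do rewrite tnth_mktuple.
have -> : [ffun s : d.-tuple 'I_n => partials y s - partials x s] =
    nabla d f y - nabla d f x.
  by apply/ffunP => s; rewrite !ffunE.
rewrite (le_trans (tensor_norm_le _ _)) // ler_wpM2r //.
by apply: prodr_ge0 => j _; exact: enorm_ge0.
Qed.

(** The one-variable estimate along s -> x + s h. It is applied with [us] empty, [[:: w]] and
    [[:: w; w]], to control f, its gradient and its Hessian. *)
Lemma taylor_mform_estimate us x h : (size us <= d)%N ->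
  `|mform (partials (x + h)) us [::] -
    \sum_(k < (d - size us).+1) k`!%:R^-1 * mform (partials x) (nseq k h ++ us) [::]|
  <= L * enorm h ^+ (d - size us).+1 * \prod_(u <- us) enorm u / (d - size us).+1`!%:R.
Proof.
move=> ud; set N := (d - size us)%N.
pose a k s := mform (partials (x + s *: h)) (nseq k h ++ us) [::].
have := @taylor_lipschitz R a (L * enorm h ^+ N.+1 * \prod_(u <- us) enorm u) N.
move=> /(_ _ _ 1 ler01); rewrite expr1n mulr1 /a scale1r scale0r addr0.
under [X in _ - X]eq_bigr do rewrite expr1n mulr1.
apply.
  move=> k s kN; apply: (@is_derive_line R n (fun y => mform (partials y) (nseq k h ++ us) [::])).
  by apply: is_derive_mform_partials; rewrite size_cat size_nseq /=; lia.
move=> s s0.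
have := @mform_lipschitz (nseq N h ++ us) x (x + s *: h).
rewrite size_cat size_nseq subnK // => /(_ erefl) H.
rewrite (le_trans H) // addrAC subrr add0r enormZ ger0_norm // big_cat /=.
rewrite big_nseq iter_mulr_1.
by rewrite le_eqVlt; apply/orP; left; apply/eqP; rewrite exprS; ring.
Qed.

End lipschitz.
End taylor_estimates.

(** * Hessians of Taylor models *)

Section polynomial_smoothness.
Variables (R : realType) (n : nat).
Implicit Types (p : 'rV[R]_n -> R) (x v : 'rV[R]_n).

Lemma is_derive_add (F G : 'rV[R]_n -> R) x v (dF dG : R) :
  is_derive x v F dF -> is_derive x v G dG ->
  is_derive x v (fun y => F y + G y) (dF + dG).
Proof. by move=> HF HG; exact: is_deriveD. Qed.

Lemma is_derive_ext p q x v l : p =1 q -> is_derive x v q l -> is_derive x v p l.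
Proof. by move=> /funext ->. Qed.

Lemma is_polynomial_derive p v : is_polynomial p ->
  exists2 dp, is_polynomial dp & forall x, is_derive x v p (dp x).
Proof.
move: p; apply: is_polynomial_ind => [p q pq|c|i|p q _ _|p q pP qP].
- by move=> [dq dqP H]; exists dq => // x; exact: is_derive_ext (H x).
- by exists (fun=> 0); [exact: is_polynomial_cst|move=> x; exact: is_derive_cst].
- exists (fun=> v 0 i); first exact: is_polynomial_cst.
  by move=> x; exact: is_derive_coord.
- move=> [dp dpP Hp] [dq dqP Hq]; exists (fun x => dp x + dq x).
    exact: is_polynomialD.
  by move=> x; exact: is_derive_add.
- move=> [dp dpP Hp] [dq dqP Hq]; exists (fun x => p x * dq x + q x * dp x).
    by apply: is_polynomialD; exact: is_polynomialM.
  by move=> x; exact: is_derive_mul.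
Qed.

Lemma is_polynomial_continuous p : is_polynomial p -> continuous p.
Proof.
move: p; apply: is_polynomial_ind => [p q /funext -> //|c|i|p q _ _|p q _ _].
- exact: cst_continuous.
- exact: coord_continuous.
- by move=> pc qc x; exact: (cvgD (pc x) (qc x)).
- by move=> pc qc x; exact: (cvgM (pc x) (qc x)).
Qed.

Lemma is_polynomial_ipartial p t : is_polynomial p -> is_polynomial (ipartial t p).
Proof.
move=> pP; elim: t => [//|i t IH] /=.
have [dp dpP H] := is_polynomial_derive (delta_mx 0 i) IH.
by apply: is_polynomial_ext dpP => x; rewrite (@derive_val _ _ _ _ _ _ _ (H x)).
Qed.

Lemma is_polynomial_smooth p k : is_polynomial p -> continuously_differentiable k p.
Proof.
move=> pP; split=> [t _ x i|t _].
  have [dp _ H] := is_polynomial_derive (delta_mx 0 i) (is_polynomial_ipartial t pP).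
  exact: @ex_derive _ _ _ _ _ _ _ (H x).
exact/is_polynomial_continuous/is_polynomial_ipartial.
Qed.

Lemma is_derive_partials_form (f : 'rV[R]_n -> R) x v : continuously_differentiable 2 f ->
  is_derive x v f (mform (partials f x) [:: v] [::]).
Proof. by move=> hf; exact: (is_derive_mform_partials hf (us := [::]) (t := [::])). Qed.

Lemma is_derive2_hessian (f : 'rV[R]_n -> R) x v : continuously_differentiable 2 f ->
  is_derive x v (fun y => mform (partials f y) [:: v] [::]) (quad_form (hessian f x) v).
Proof.
move=> hf; rewrite quad_form_hessian.
exact: (is_derive_mform_partials hf (us := [:: v]) (t := [::])).
Qed.

Lemma quad_form_hessianE (f f1 f2 : 'rV[R]_n -> R) v : continuously_differentiable 2 f ->
  (forall x, is_derive x v f (f1 x)) -> (forall x, is_derive x v f1 (f2 x)) ->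
  forall x, quad_form (hessian f x) v = f2 x.
Proof.
move=> hf H1 H2 x; have D := is_derive2_hessian x v hf.
rewrite -(@derive_val _ _ _ _ _ _ _ (H2 x)) -(@derive_val _ _ _ _ _ _ _ D).
congr ('D_v _ x); apply/funext => y.
rewrite -(@derive_val _ _ _ _ _ _ _ (H1 y)).
by rewrite -(@derive_val _ _ _ _ _ _ _ (is_derive_partials_form y v hf)).
Qed.

Lemma is_derive_shift_arg (g : 'rV[R]_n -> R) x y v l :
  is_derive (y - x) v g l -> is_derive y v (fun z => g (z - x)) l.
Proof.
move=> /is_deriveP H; apply/is_deriveP.
rewrite (_ : (fun t => _) = (fun t : R => t^-1 * (g (t *: v + (y - x)) - g (y - x)))) //.
by apply/funext => t; rewrite addrA.
Qed.

Definition sqnorm x := \sum_(i < n) x 0 i ^+ 2.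
Definition dotp x v := \sum_(i < n) x 0 i * v 0 i.

Lemma sqnormE x : sqnorm x = enorm x ^+ 2.
Proof. by rewrite enorm_sqr. Qed.

Lemma is_derive_dotp x v w : is_derive x w (fun y => dotp y v) (dotp w v).
Proof.
apply: is_derive_fsum => i; have := is_derive_mul (is_derive_coord x w i)
  (is_derive_cst (v 0 i) x w).
rewrite mulr0 add0r [w 0 i * _]mulrC. by apply.
Qed.

Lemma is_derive_sqnorm x v : is_derive x v sqnorm (2 * dotp x v).
Proof.
rewrite /dotp mulr_sumr; apply: is_derive_fsum => i.
have := is_derive_mul (is_derive_coord x v i) (is_derive_coord x v i).
rewrite (_ : _ * _ + _ = 2 * (x 0 i * v 0 i)); last by ring.
by apply: is_derive_ext.
Qed.

Lemma is_derive_sqnormX a x v :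
  is_derive x v (fun y => sqnorm y ^+ a) (a%:R * sqnorm x ^+ a.-1 * (2 * dotp x v)).
Proof.
have D := is_derive_sqnorm x v.
by apply: is_derive_ext (@is_deriveX _ _ sqnorm a x v _ D) => y; rewrite fctE.
Qed.

Lemma is_derive2_sqnormX a x v :
  is_derive x v (fun y => a.+1%:R * sqnorm y ^+ a * (2 * dotp y v))
    (a.+1%:R * 2 * (sqnorm x ^+ a * sqnorm v +
      (2 * a)%:R * (sqnorm x ^+ a.-1 * dotp x v ^+ 2))).
Proof.
have H1 := is_derive_mul (is_derive_cst (a.+1%:R : R) x v) (is_derive_sqnormX a x v).
have H2 := is_derive_mul (is_derive_cst (2 : R) x v) (is_derive_dotp x v v).
have := is_derive_mul H1 H2; rewrite /cst.
have -> : dotp v v = sqnorm v by apply: eq_bigr => i _; rewrite expr2.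
congr (is_derive _ _ _ _); rewrite natrM; ring.
Qed.

Lemma is_polynomial_sqnorm : is_polynomial sqnorm.
Proof.
by apply: is_polynomial_sum => i; apply: is_polynomialX; exact: is_polynomial_coord.
Qed.

Lemma is_polynomial_shift p x : is_polynomial p -> is_polynomial (fun y => p (y - x)).
Proof.
apply: is_polynomial_comp => i.
apply: (@is_polynomial_ext _ _ _ (fun y => y 0 i - x 0 i)).
  by move=> y; rewrite !mxE.
by apply: is_polynomialB; [exact: is_polynomial_coord|exact: is_polynomial_cst].
Qed.

Lemma enorm_pow_sqnorm d x : odd d -> enorm x ^+ d.+1 = sqnorm x ^+ (d./2).+1.
Proof. by move=> od; rewrite sqnormE -exprM; congr (_ ^+ _); lia. Qed.

(** Coefficients [c] replace the derivatives of f, so that constants obtained later depend on bounds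
    for [c] only. Differentiating along [w] lowers [D] and puts [w] into [us]. *)
Definition tpoly (c : seq 'I_n -> R) (D : nat) (us : seq 'rV[R]_n) h :=
  \sum_(k < D.+1) k`!%:R^-1 * mform c (nseq k h ++ us) [::].

Lemma is_derive_tpoly c d D us h w : perm_invariant d c -> (D.+1 + size us <= d)%N ->
  is_derive h w (tpoly c D.+1 us) (tpoly c D (w :: us) h).
Proof.
move=> cP sd.
rewrite (_ : tpoly c D (w :: us) h = \sum_(k < D.+2) k`!%:R^-1 *
   (k%:R * mform c (w :: nseq k.-1 h ++ us) [::])).
  apply: is_derive_fsum => k.
  have := is_derive_mul (is_derive_cst (k`!%:R^-1 : R) h w)
    (is_derive_mform_nseq (k := k) (us := us) (t := [::]) h w cP _).
  rewrite mulr0 addr0; apply; move: (ltn_ord k) sd => /=; lia.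
rewrite big_ord_recl mul0r mulr0 add0r; apply: eq_bigr => k _.
rewrite lift0 /= factS natrM invfM (mform_nseq_cat (d := d)) //; last first.
  by move: (ltn_ord k) sd => /=; lia.
by rewrite mulrACA mulVf ?mul1r ?pnatr_eq0.
Qed.

Lemma taylor_tpoly d (f : 'rV[R]_n -> R) x y :
  taylor d f x y = tpoly (partials f x) d [::] (y - x).
Proof. by rewrite taylorE; apply: eq_bigr => k _; rewrite cats0. Qed.

Lemma is_polynomial_mform_nseq c k t : is_polynomial (fun h : 'rV[R]_n => mform c (nseq k h) t).
Proof.
elim: k t => [|k IH] t; first exact: is_polynomial_cst.
by apply: is_polynomial_sum => i; apply: is_polynomialM => //; exact: is_polynomial_coord.
Qed.

Lemma is_polynomial_tpoly c D : is_polynomial (tpoly c D [::]).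
Proof.
apply: is_polynomial_sum => k; apply: is_polynomialZ.
apply: is_polynomial_ext (is_polynomial_mform_nseq c k [::]) => h.
by rewrite cats0.
Qed.

Section shifted_taylor.
Variables (d : nat) (c : seq 'I_n -> R) (x : 'rV[R]_n).
Hypothesis hd : (3 <= d)%N.
Hypothesis od : odd d.
Hypothesis cP : perm_invariant d c.

Definition model t y := tpoly c d [::] (y - x) + t * enorm (y - x) ^+ d.+1.

(** The derivative of [model t] along [v]; [model2] is the second one. Since d is odd,
    [sqnorm (y - x) ^+ d./2] is |y - x|^(d-1). *)
Definition model1 t v y :=
  tpoly c d.-1 [:: v] (y - x) +
  t * (d.+1%:R * (sqnorm (y - x) ^+ d./2 * dotp (y - x) v)).

Definition model2 t v y :=
  tpoly c d.-2 [:: v; v] (y - x) +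
  t * (d.+1%:R * (sqnorm (y - x) ^+ d./2 * sqnorm v +
     d.-1%:R * (sqnorm (y - x) ^+ d./2.-1 * dotp (y - x) v ^+ 2))).

Let d1 : d.+1%:R = (d./2).+1%:R * 2 :> R.
Proof. by rewrite -natrM; congr _%:R; lia. Qed.

Lemma is_polynomial_model t : is_polynomial (model t).
Proof.
apply: is_polynomialD; first exact/is_polynomial_shift/is_polynomial_tpoly.
apply: is_polynomialZ.
apply: (@is_polynomial_ext _ _ _ (fun y => sqnorm (y - x) ^+ (d./2).+1)).
  by move=> y; rewrite enorm_pow_sqnorm.
apply: (@is_polynomial_shift (fun y => sqnorm y ^+ _)).
exact/is_polynomialX/is_polynomial_sqnorm.
Qed.

Lemma is_derive_model t v y : is_derive y v (model t) (model1 t v y).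
Proof.
apply: is_derive_add.
  apply: is_derive_shift_arg; rewrite -{1}(prednK (_ : (0 < d)%N)); last by lia.
  by apply: (is_derive_tpoly _ _ cP) => /=; lia.
have := is_derive_mul (is_derive_cst (t : R) y v)
  (is_derive_shift_arg (is_derive_sqnormX (d./2).+1 (y - x) v)).
rewrite mulr0 addr0 /cst /= => H.
rewrite (_ : t * _ = t * ((d./2).+1%:R * sqnorm (y - x) ^+ d./2 * (2 * dotp (y - x) v))).
  by apply: is_derive_ext H => z; rewrite enorm_pow_sqnorm.
by rewrite d1; ring.
Qed.

Lemma is_derive_model1 t v y : is_derive y v (model1 t v) (model2 t v y).
Proof.
apply: is_derive_add.
  apply: is_derive_shift_arg; rewrite -(prednK (_ : (0 < d.-1)%N)); last by lia.
  by apply: (is_derive_tpoly _ _ cP) => /=; lia.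
have := is_derive_mul (is_derive_cst (t : R) y v)
  (is_derive_shift_arg (is_derive2_sqnormX d./2 (y - x) v)).
rewrite mulr0 addr0 /cst /= -d1 (_ : (2 * d./2 = d.-1)%N); last by lia.
by apply: is_derive_ext => z; rewrite d1; ring.
Qed.

Lemma quad_form_hessian_model t v y :
  quad_form (hessian (model t) y) v = model2 t v y.
Proof.
apply: (quad_form_hessianE _ (is_derive_model t v) (is_derive_model1 t v)).
exact/is_polynomial_smooth/is_polynomial_model.
Qed.

End shifted_taylor.
End polynomial_smoothness.

(** * Uniform SOS-convexity of Taylor models *)

Section psd_forms.
Variables (R : realType) (n N : nat) (v : 'I_n -> 'rV[R]_N -> R).
Hypothesis vP : forall i, is_polynomial (v i).
Implicit Types (A : 'I_n -> 'I_n -> R) (x y : 'I_n -> R).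

Let B A x y := \sum_(i < n) \sum_(j < n) A i j * (x i * y j).
Let e (i : 'I_n) : 'I_n -> R := fun j => (j == i)%:R.

Lemma sum_kronecker (F : 'I_n -> R) i : \sum_(j < n) F j * (j == i)%:R = F i.
Proof.
rewrite (bigD1 i) //= eqxx mulr1 big1 ?addr0 // => j /negPf ->.
by rewrite mulr0.
Qed.

Let B_e A x i : B A x (e i) = \sum_(j < n) A j i * x j.
Proof.
apply: eq_bigr => j _; rewrite -(sum_kronecker (fun k => A j k * x j)).
by apply: eq_bigr => k _; rewrite mulrA.
Qed.

Let B_ee A i : B A (e i) (e i) = A i i.
Proof. by rewrite B_e sum_kronecker. Qed.

Let B_expand A x y t : (forall i j, A i j = A j i) ->
  B A (fun i => x i + t * y i) (fun i => x i + t * y i) =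
  B A x x + 2 * t * B A x y + t ^+ 2 * B A y y.
Proof.
move=> As; have -> : B A x y = 2^-1 * (B A x y + B A y x).
  suff -> : B A y x = B A x y by field.
  rewrite [LHS]exchange_big; apply: eq_bigr => i _; apply: eq_bigr => j _.
  by rewrite As; ring.
rewrite /B -!big_split !mulr_sumr -!big_split /=; apply: eq_bigr => i _.
rewrite -!big_split !mulr_sumr -!big_split /=; apply: eq_bigr => j _.
by field.
Qed.

(** Completion of squares, by induction on the number of nonzero diagonal entries; a zero diagonal
    entry of a positive semidefinite form has a zero row. *)
Lemma psd_form_is_sos A : (forall i j, A i j = A j i) ->
  (forall x, 0 <= \sum_(i < n) \sum_(j < n) A i j * (x i * x j)) ->
  is_sos (fun z => \sum_(i < n) \sum_(j < n) A i j * (v i z * v j z)).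
Proof.
have [m] := ubnP #|[pred i | (A i i != 0)%R]|; elim: m A => // m IH A Am As Ap.
have row0 i j : A i i = 0 -> A i j = 0.
  move=> Aii; apply/eqP; apply: contraT => Aij.
  (* With this [t] the form takes the value -1 at e_j + t e_i. *)
  pose t := - (A j j + 1) / (2 * A i j).
  have := Ap (fun k => e j k + t * e i k); rewrite -/(B A _ _) (B_expand _ _ _ As).
  rewrite !B_ee B_e sum_kronecker As Aii mulr0 addr0 (As i j).
  rewrite (_ : 2 * t * A j i = - (A j j + 1)) => [|]; first by lra.
  by rewrite /t (As i j); field; rewrite As.
have [/existsP[i Aii]|/existsPn A0] := boolP [exists i, A i i != 0]; last first.
  apply: is_sos_ext (is_sos0 _ _) => z; apply: big1 => i _; apply: big1 => j _.
  by rewrite row0 ?mul0r //; apply/eqP; have := A0 i; rewrite negbK.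
have Aii0 : 0 < A i i.
  by rewrite lt_def Aii -B_ee; exact: Ap.
(* The Schur complement: its entry at (i, i) vanishes, and zero diagonal entries stay zero because
   their rows are zero. *)
pose A' j k := A j k - A i j * A i k / A i i.
have A'm : (#|[pred j | (A' j j != 0)%R]| < m)%N.
  rewrite -ltnS (leq_ltn_trans _ Am) //.
  apply: proper_card; apply/properP; split.
    apply/fintype.subsetP => j; rewrite !inE; apply: contra => /eqP Ajj.
    by rewrite /A' Ajj (As i j) (row0 j i Ajj) !mul0r subrr.
  by exists i; rewrite ?inE // negbK /A' mulfK // subrr eqxx.
have Q' (x : 'I_n -> R) : B A' x x = B A x x - (\sum_(j < n) A i j * x j) ^+ 2 / A i i.
  have -> : (\sum_(j < n) A i j * x j) ^+ 2 / A i i =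
      \sum_(j < n) \sum_(k < n) A i j * A i k / A i i * (x j * x k).
    rewrite expr2 mulr_suml mulr_suml; apply: eq_bigr => j _.
    rewrite mulr_sumr mulr_suml; apply: eq_bigr => k _; by field.
  rewrite -sumrB; apply: eq_bigr => j _; rewrite -sumrB; apply: eq_bigr => k _.
  by rewrite mulrBl.
have A'p x : 0 <= B A' x x.
  rewrite Q'; set l := \sum_(j < n) _.
  (* The multiple of e_i that minimizes the form, with minimum B A' x x. *)
  have := Ap (fun k => x k + (- l / A i i) * e i k).
  rewrite -/(B A _ _) (B_expand _ _ _ As) B_ee B_e.
  have -> : \sum_(j < n) A j i * x j = l by apply: eq_bigr => j _; rewrite As.
  by congr (0 <= _); field.
have A's j k : A' j k = A' k j by rewrite /A' As (mulrC (A i j)).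
have i0 : 0 <= (A i i)^-1 by rewrite invr_ge0 ltW.
apply: is_sos_ext (is_sosD (IH A' A'm A's A'p) (is_sosZ i0 (is_sos_sqr
  (is_polynomial_sum (index_enum 'I_n) (fun j => is_polynomialZ (A i j) (vP j)))))) => z.
have := Q' (fun j => v j z); rewrite /B => -> /=.
by rewrite [_^-1 * _]mulrC subrK.
Qed.

End psd_forms.

Section uniform_shift.
Variables (R : realType) (n d : nat) (mu K : R).
Hypothesis hd : (3 <= d)%N.
Hypothesis od : odd d.
Hypothesis mu0 : 0 < mu.
Hypothesis K0 : 0 <= K.

Let h (z : 'rV[R]_(n + n)) : 'rV[R]_n := lsubmx z.
Let v (z : 'rV[R]_(n + n)) : 'rV[R]_n := rsubmx z.

Let hP i : is_polynomial (fun z => h z 0 i).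
Proof.
by apply: is_polynomial_ext (is_polynomial_coord R (lshift n i)) => z; rewrite mxE.
Qed.

Let vP i : is_polynomial (fun z => v z 0 i).
Proof.
by apply: is_polynomial_ext (is_polynomial_coord R (rshift n i)) => z; rewrite mxE.
Qed.

Let sqnormP (u : 'rV[R]_(n + n) -> 'rV[R]_n) :
  (forall i, is_polynomial (fun z => u z 0 i)) -> is_sos (fun z => sqnorm (u z)).
Proof. by move=> uP; apply: is_sos_sum => i; exact/is_sos_sqr/uP. Qed.

Lemma mform_pair c k x w : perm_invariant d c -> (k + 2 <= d)%N ->
  mform c (nseq k x ++ [:: w; w]) [::] =
  \sum_(q : k.-tuple 'I_n * ('I_n * 'I_n)) c [:: q.2.1, q.2.2 & q.1] *
    (\prod_(l <- q.1) x 0 l * (w 0 q.2.1 * w 0 q.2.2)) :> R.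
Proof.
move=> cP kd; rewrite (mform_nseq_cat (d := d)) //=; last by lia.
transitivity (\sum_(i < n) \sum_(j < n) \sum_(s : k.-tuple 'I_n)
    c [:: i, j & s] * (\prod_(l <- s) x 0 l * (w 0 i * w 0 j))).
  apply: eq_bigr => i _; rewrite (mform_nseq_cat (d := d)) //=; last by lia.
  rewrite mulr_sumr; apply: eq_bigr => j _; rewrite cats0 mform_nseq !mulr_sumr.
  by apply: eq_bigr => s _; rewrite /=; ring.
rewrite pair_big /= exchange_big /= pair_big /=.
by apply: eq_bigr => -[s [i j]].
Qed.

(** Three pieces: the constant form minus mu |v|^2, a sum of squares by positivity; the monomials of
    degree 1 to d - 2 in h, dominated by mu |v|^2 + C |h|^(d-1) |v|^2; and the Hessian of |h|^(d+1),
    which pays for C. Hence [B] depends on [mu], [K], [d] and [n], not on [c]. *)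
Lemma sos_model2 : exists2 B : R, 0 <= B & forall c, perm_invariant d c ->
  (forall t, (size t <= d)%N -> `|c t| <= K) ->
  (forall w, mu * sqnorm w <= mform c [:: w; w] [::]) ->
  is_sos (fun z => tpoly c d.-2 [:: v z; v z] (h z) +
    B * (d.+1%:R * (sqnorm (h z) ^+ d./2 * sqnorm (v z) +
     d.-1%:R * (sqnorm (h z) ^+ d./2.-1 * dotp (h z) (v z) ^+ 2)))).
Proof.
pose T (k : 'I_d.-2) : finType := (k.+1.-tuple 'I_n * ('I_n * 'I_n))%type.
have dom := sos_dominated_sum vP (index_enum 'I_d.-2) (fun k : 'I_d.-2 =>
  sos_dominated_sum vP (index_enum (T k)) (fun q : T k =>
    @sos_dominated_mono R n _ (fun i z => h z 0 i) (fun i z => v z 0 i) hP vP d./2 K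
      q.1 q.2.1 q.2.2 K0 _)).
(* The tolerance is [mu]: the domination spends exactly the |v|^2 term left over by the constant
   form. *)
have [|C C0 HC] := dom _ mu mu0.
  by move=> k q; rewrite size_tuple; move: (ltn_ord k); lia.
have d0 : (d.+1%:R : R) != 0 by rewrite pnatr_eq0.
have B0 : 0 <= C / d.+1%:R by rewrite divr_ge0.
exists (C / d.+1%:R) => // c cP cK cmu.
have S1 : is_sos (fun z => \sum_(i < n) \sum_(j < n)
    (c [:: i; j] - mu * (i == j)%:R) * (v z 0 i * v z 0 j)).
  apply: psd_form_is_sos => //.
    move=> i j; rewrite (eq_sym i) (cP [:: i; j] [:: j; i]) //=; last by lia.
    by rewrite -[[:: i; j]]/([:: i] ++ [:: j]) perm_catC perm_refl.
  move=> x; have := cmu (\row_i x i); rewrite -subr_ge0; congr (0 <= _).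
  rewrite /sqnorm /= mulr_sumr -sumrB; apply: eq_bigr => i _.
  under [in RHS]eq_bigr do rewrite mulrBl.
  rewrite sumrB mulr_sumr; congr (_ - _).
    by apply: eq_bigr => j _; rewrite !mxE; ring.
  rewrite mxE expr2 -(sum_kronecker (fun j => mu * (x i * x j)) i).
  by apply: eq_bigr => j _; rewrite eq_sym; ring.
have S2 := HC (fun z => \sum_(k < d.-2) \sum_(q : k.+1.-tuple 'I_n * ('I_n * 'I_n))
   (k.+1`!%:R^-1 * c [:: q.2.1, q.2.2 & q.1]) *
   (\prod_(l <- q.1) h z 0 l * (v z 0 q.2.1 * v z 0 q.2.2))) _.
have S3 : is_sos (fun z => C * d.-1%:R *
    (sqnorm (h z) ^+ d./2.-1 * dotp (h z) (v z) ^+ 2)).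
  apply: is_sosZ; first by rewrite mulr_ge0.
  apply: is_sosM; first exact/is_sosX/sqnormP.
  by apply/is_sos_sqr/is_polynomial_sum => i; exact: is_polynomialM.
apply: is_sos_ext (is_sosD S1 (is_sosD (S2 _) S3)) => [z|]; last first.
  exists (fun (k : 'I_d.-2) z =>
   \sum_(q : k.+1.-tuple 'I_n * ('I_n * 'I_n)) (k.+1`!%:R^-1 * c [:: q.2.1, q.2.2 & q.1]) *
   (\prod_(l <- q.1) h z 0 l * (v z 0 q.2.1 * v z 0 q.2.2))); split => // k.
  exists (fun (q : k.+1.-tuple 'I_n * ('I_n * 'I_n)) z =>
   (k.+1`!%:R^-1 * c [:: q.2.1, q.2.2 & q.1]) *
   (\prod_(l <- q.1) h z 0 l * (v z 0 q.2.1 * v z 0 q.2.2))); split => // q.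
  exists (k.+1`!%:R^-1 * c [:: q.2.1, q.2.2 & q.1]) => //.
  (* The factor 1/(k+1)! is at most 1, so the bound [K] on [c] also bounds the Taylor
     coefficients. *)
  rewrite normrM ger0_norm ?invr_ge0 //.
  have cKq : `|c [:: q.2.1, q.2.2 & q.1]| <= K.
    by apply: cK; rewrite /= size_tuple; move: (ltn_ord k); lia.
  rewrite (le_trans _ cKq) // ler_piMl //.
  by rewrite invf_le1 ?ltr0n ?fact_gt0 // ler1n fact_gt0.
rewrite /= -/(sqnorm (h z)) -/(sqnorm (v z)) /tpoly big_ord_recl /= invr1 mul1r.
have -> : \sum_(k < d.-2) (bump 0 k)`!%:R^-1 * mform c (nseq (bump 0 k) (h z) ++
    [:: v z; v z]) [::]
  = \sum_(k < d.-2) \sum_(q : k.+1.-tuple 'I_n * ('I_n * 'I_n)) (k.+1`!%:R^-1 * c [:: q.2.1, q.2.2 & q.1]) *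
   (\prod_(l <- q.1) h z 0 l * (v z 0 q.2.1 * v z 0 q.2.2)).
  apply: eq_bigr => k _; rewrite (_ : bump 0 k = k.+1) // mform_pair //; last first.
    by move: (ltn_ord k) => /=; lia.
  rewrite mulr_sumr; apply: eq_bigr => q _. exact: mulrA.
have -> : \sum_(i < n) \sum_(j < n) (c [:: i; j] - mu * (i == j)%:R) * (v z 0 i * v z 0 j)
    = mform c [:: v z; v z] [::] - mu * sqnorm (v z).
  rewrite /sqnorm /= mulr_sumr -sumrB; apply: eq_bigr => i _.
  under eq_bigr do rewrite mulrBl.
  rewrite sumrB mulr_sumr; congr (_ - _).
    by apply: eq_bigr => j _; ring.
  rewrite expr2 -(sum_kronecker (fun j => mu * (v z 0 i * v z 0 j)) i).
  by apply: eq_bigr => j _; rewrite eq_sym; ring.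
rewrite /=; field; by rewrite nat1r.
Qed.

End uniform_shift.

Lemma is_sos_comp (R : realType) (n N : nat) (p : 'rV[R]_n -> R)
    (u : 'rV[R]_N -> 'rV[R]_n) :
  (forall i, is_polynomial (fun z => u z 0 i)) ->
  is_sos p -> is_sos (fun z => p (u z)).
Proof.
move=> uP [qs pE]; apply: (@is_sos_ext _ _ _ (fun z => \sum_(q <- qs) poly_fun q (u z) ^+ 2)).
  by move=> z; rewrite pE.
apply: is_sos_sum => q; apply: is_sos_sqr; apply: is_polynomial_comp => //.
by exists q.
Qed.

Lemma sos_convex_model (R : realType) (n d : nat) (mu K : R) :
  (3 <= d)%N -> odd d -> 0 < mu -> 0 <= K ->
  exists2 B : R, 0 <= B & forall (c : seq 'I_n -> R) (x : 'rV[R]_n), perm_invariant d c ->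
    (forall t, (size t <= d)%N -> `|c t| <= K) ->
    (forall w, mu * sqnorm w <= mform c [:: w; w] [::]) ->
    sos_convex (model d c x B).
Proof.
move=> hd od mu0 K0; have [B B0 HB] := @sos_model2 R n d mu K hd od mu0 K0.
exists B => // c x cP cK cmu; split; first exact: is_polynomial_model.
pose u (z : 'rV[R]_(n + n)) : 'rV[R]_(n + n) := row_mx (lsubmx z - x) (rsubmx z).
have uP i : is_polynomial (fun z => u z 0 i).
  case: (split_ordP i) => j ->.
    apply: (@is_polynomial_ext _ _ _ (fun z => z 0 (lshift n j) - x 0 j)).
      by move=> z; rewrite row_mxEl !mxE.
    by apply: is_polynomialB; [exact: is_polynomial_coord|exact: is_polynomial_cst].
  apply: is_polynomial_ext (is_polynomial_coord R (rshift n j)) => z.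
  by rewrite row_mxEr mxE.
apply: is_sos_ext (is_sos_comp uP (HB c cP cK cmu)) => z.
by rewrite quad_form_hessian_model // /model2 row_mxKl row_mxKr.
Qed.

(** * Convexity and the SOS shift *)

Lemma continuously_differentiableW (R : realType) (n j k : nat) (f : 'rV[R]_n -> R) :
  (j <= k)%N -> continuously_differentiable k f -> continuously_differentiable j f.
Proof.
move=> jk [df cf]; split=> [t tj|t tj]; first by apply: df; exact: leq_trans jk.
by apply: cf; exact: leq_trans jk.
Qed.

Lemma convex_on_line (R : realType) (n : nat) (p : 'rV[R]_n -> R) (k : R)
    (x w : 'rV[R]_n) : continuously_differentiable 2 p ->
  (forall y, k <= quad_form (hessian p y) w) -> forall a, 0 <= a <= 1 ->
  p (x + a *: w) <= (1 - a) * p x + a * p (x + w) - k / 2 * (a * (1 - a)).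
Proof.
move=> pC pk a a01.
have := @convex_of_second_derivative R (fun s => p (x + s *: w))
  (fun s => mform (partials p (x + s *: w)) [:: w] [::])
  (fun s => quad_form (hessian p (x + s *: w)) w) k _ _ _ a a01.
rewrite scale0r scale1r addr0; apply=> [s|s|s]; last exact: pk.
  by apply: is_derive_line; exact: is_derive_partials_form.
by apply: (@is_derive_line _ _ (fun y => mform (partials p y) [:: w] [::]));
  exact: is_derive2_hessian.
Qed.

Lemma sos_convex_quad_form_ge0 (R : realType) (n : nat) (p : 'rV[R]_n -> R) y v :
  sos_convex p -> 0 <= quad_form (hessian p y) v.
Proof.
by move=> [_ /is_sos_ge0/(_ (row_mx y v))]; rewrite row_mxKl row_mxKr.
Qed.

Lemma sos_convex_on_line (R : realType) (n : nat) (p : 'rV[R]_n -> R)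
    (x w : 'rV[R]_n) a : sos_convex p -> 0 <= a <= 1 ->
  p (x + a *: w) <= (1 - a) * p x + a * p (x + w).
Proof.
move=> pS a01; have pC := is_polynomial_smooth 2 pS.1.
have := convex_on_line (k := 0) x pC (fun y => sos_convex_quad_form_ge0 y w pS) a01.
by rewrite !mul0r subr0.
Qed.

Lemma feasible_convex (R : realType) (n m : nat) (g : 'I_m -> 'rV[R]_n -> R)
    (x y : 'rV[R]_n) a : (forall i, sos_convex (g i)) -> 0 <= a <= 1 ->
  feasible g x -> feasible g y -> feasible g (x + a *: (y - x)).
Proof.
move=> gS /[dup] /andP[a0 a1] a01 gx gy i.
rewrite (le_trans (sos_convex_on_line _ _ (gS i) a01)) // (addrC x) subrK.
by rewrite -oppr_ge0 opprD addr_ge0 // oppr_ge0 mulr_ge0_le0 ?subr_ge0.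
Qed.

Lemma feasible_closed (R : realType) (n m : nat) (g : 'I_m -> 'rV[R]_n -> R) :
  (forall i, sos_convex (g i)) -> closed (feasible g).
Proof.
move=> gS; have -> : feasible g = \bigcap_(i in setT) [set x | g i x <= 0].
  by apply/seteqP; split=> [x gx i _|x gx i]; exact: gx.
apply: closed_bigI => i _; rewrite -[X in closed X]/(g i @^-1` [set y | y <= 0]).
apply: closed_comp; last exact: closed_le.
by move=> x _; exact/is_polynomial_continuous/(gS i).1.
Qed.

Lemma compact_enorm_ball (R : realType) (n : nat) (x : 'rV[R]_n) (r : R) :
  0 <= r -> compact [set z | enorm (z - x) <= r].
Proof.
move=> r0; apply: bounded_closed_compact.
  exists (`|x| + r); split; first exact: num_real.
  move=> b lt_b z /= zr; rewrite -(subrK x z) (le_trans (ler_normD _ _)) //.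
  by rewrite addrC (le_trans _ (ltW lt_b)) // lerD2l (le_trans (norm_le_enorm _)).
have -> : [set z | enorm (z - x) <= r] =
    (fun z => sqnorm (z - x)) @^-1` [set y | y <= r ^+ 2].
  by apply/seteqP; split=> z /=; rewrite sqnormE ler_sqr ?nnegrE ?enorm_ge0.
apply: closed_comp; last exact: closed_le.
by move=> z _; exact/is_polynomial_continuous/is_polynomial_shift/is_polynomial_sqnorm.
Qed.

Lemma continuous_fsum (R : realType) (n : nat) (I : Type) (s : seq I)
    (F : I -> 'rV[R]_n -> R) : (forall i, continuous (F i)) ->
  continuous (fun x => \sum_(i <- s) F i x).
Proof.
move=> FC; elim: s => [|i s IH].
  by under eq_fun do rewrite big_nil; exact: cst_continuous.
by under eq_fun do rewrite big_cons; move=> x; exact: (cvgD (FC i x) (IH x)).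
Qed.

Lemma partials_bounded (R : realType) (n d : nat) (f : 'rV[R]_n -> R) x0 (r : R) :
  continuously_differentiable d f -> 0 <= r ->
  exists2 K, 0 <= K & forall z, enorm (z - x0) <= r ->
    forall t, (size t <= d)%N -> `|partials f z t| <= K.
Proof.
move=> [_ fC] r0.
(* A single continuous function above all partial derivatives, whose maximum on the compact ball
   serves as [K]. *)
pose G z := \sum_(k < d.+1) \sum_(s : k.-tuple 'I_n) `|ipartial s f z|.
have GC : continuous G.
  apply: continuous_fsum => k; apply: continuous_fsum => s z.
  have sd : (size s <= d)%N by rewrite size_tuple -ltnS.
  exact: (cvg_norm (fC s sd z)).
have [|||z0 _ H] := @EVT_max_rV R n G [set z | enorm (z - x0) <= r].
- by exists x0; rewrite /= subrr enorm0.
- exact: compact_enorm_ball.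
- exact: continuous_subspaceT.
exists (G z0); first by apply: sumr_ge0 => k _; apply: sumr_ge0.
move=> z zr t td; apply: (@le_trans _ _ (G z)); last by apply: H; rewrite inE.
rewrite -ltnS in td; rewrite /G (bigD1 (Ordinal td)) //=.
rewrite (bigD1 (in_tuple t)) //= -addrA lerDl addr_ge0 ?sumr_ge0 // => k _.
exact: sumr_ge0.
Qed.

Section model_shift.
Variables (R : realType) (n d : nat) (c : seq 'I_n -> R) (x : 'rV[R]_n).
Hypothesis hd : (3 <= d)%N.
Hypothesis od : odd d.
Hypothesis cP : perm_invariant d c.

(** The Hessian form of |y - x|^(d+1) is itself a sum of squares, so enlarging the weight adds
    one. *)
Lemma sos_convex_model_mono (s t : R) :
  sos_convex (model d c x s) -> s <= t -> sos_convex (model d c x t).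
Proof.
move=> [_ sS] st; split; first exact: is_polynomial_model.
pose h (z : 'rV[R]_(n + n)) : 'rV[R]_n := lsubmx z - x.
have hP i : is_polynomial (fun z => h z 0 i).
  apply: (@is_polynomial_ext _ _ _ (fun z => z 0 (lshift n i) - x 0 i)).
    by move=> z; rewrite !mxE.
  by apply: is_polynomialB; [exact: is_polynomial_coord|exact: is_polynomial_cst].
have vP i : is_polynomial (fun z : 'rV[R]_(n + n) => (rsubmx z : 'rV[R]_n) 0 i).
  by apply: is_polynomial_ext (is_polynomial_coord R (rshift n i)) => z; rewrite mxE.
have hS k : is_sos (fun z => sqnorm (h z) ^+ k).
  by apply/is_sosX/is_sos_sum => i; exact/is_sos_sqr.
have vS : is_sos (fun z : 'rV[R]_(n + n) => sqnorm (rsubmx z : 'rV[R]_n)).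
  by apply/is_sos_sum => i; exact/is_sos_sqr.
have dS : is_sos (fun z => dotp (h z) (rsubmx z) ^+ 2).
  by apply/is_sos_sqr/is_polynomial_sum => i; exact: is_polynomialM.
have ts0 : 0 <= (t - s) * d.+1%:R by rewrite mulr_ge0 ?subr_ge0.
have d0 : 0 <= d.-1%:R :> R by [].
apply: is_sos_ext (is_sosD sS (is_sosZ ts0 (is_sosD (is_sosM (hS d./2) vS)
  (is_sosZ d0 (is_sosM (hS d./2.-1) dS))))) => z.
by rewrite !quad_form_hessian_model // /model2 /=; ring.
Qed.

(** By monotonicity every weight above the infimum is SOS-convex, so the affine inequality holds at
    u + q for all q > 0 and passes to the limit at u. *)
Lemma inf_shift_linear (T : set R) (a b u : R) :
  (forall t, T t -> sos_convex (model d c x t)) -> T !=set0 -> inf T <= u ->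
  (forall t, sos_convex (model d c x t) -> 0 <= a + t * b) -> 0 <= a + u * b.
Proof.
move=> TS T0 Tu H.
apply/ler_addgt0Pl => e e0.
pose q := e / (`|b| + 1).
have b1 : 0 < `|b| + 1 by rewrite ltr_wpDl.
have q0 : 0 < q by rewrite divr_gt0.
have uq : u < u + q by rewrite ltrDl.
have [t Tt /ltW tu] := inf_lt T0 (le_lt_trans Tu uq).
have := H (u + q).
have sq : sos_convex (model d c x (u + q)).
  exact: sos_convex_model_mono (TS t Tt) tu.
have qb : q * b <= e.
  rewrite (le_trans (ler_norm _)) // normrM (ger0_norm (ltW q0)) /q.
  by rewrite mulrAC ler_pdivrMr // ler_pM2l // lerDl.
by move=> /(_ sq); rewrite mulrDl; lra.
Qed.

End model_shift.

(** * Restriction of a model to a line *)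

Lemma horner_inj (R : realType) (p q : {poly R}) : (forall s, p.[s] = q.[s]) -> p = q.
Proof.
move=> pq; apply/eqP; rewrite -subr_eq0; apply/eqP.
apply: (@roots_geq_poly_eq0 _ _ [seq i%:R | i <- iota 0 (size (p - q))]).
- by apply/allP => s _; rewrite /root hornerD hornerN pq subrr.
- rewrite map_inj_uniq ?iota_uniq // => i j /eqP.
  by rewrite eqr_nat => /eqP.
- by rewrite size_map size_iota.
Qed.

Definition polynomial_of_degree_le (R : realType) (D : nat) (F : R -> R) :=
  exists2 P : {poly R}, (size P <= D.+1)%N & forall s, F s = P.[s].

Section restriction_to_a_line.
Variables (R : realType) (n : nat) (u w : 'rV[R]_n).
Implicit Types (F G : R -> R).

Lemma degree_leD D F G : polynomial_of_degree_le D F -> polynomial_of_degree_le D G ->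
  polynomial_of_degree_le D (fun s => F s + G s).
Proof.
move=> [P sP FP] [Q sQ GQ]; exists (P + Q) => [|s]; last by rewrite FP GQ hornerD.
by rewrite (leq_trans (size_polyD _ _)) // geq_max sP.
Qed.

Lemma degree_leM D D' F G : polynomial_of_degree_le D F -> polynomial_of_degree_le D' G ->
  polynomial_of_degree_le (D + D') (fun s => F s * G s).
Proof.
move=> [P sP FP] [Q sQ GQ]; exists (P * Q) => [|s]; last by rewrite FP GQ hornerM.
by rewrite (leq_trans (size_polyMleq _ _)) //; lia.
Qed.

Lemma degree_le_cst D (a : R) : polynomial_of_degree_le D (fun=> a).
Proof.
exists a%:P => [|s]; last by rewrite hornerC.
by rewrite (leq_trans (size_polyC_leq1 a)).
Qed.

Lemma degree_leZ D F a : polynomial_of_degree_le D F ->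
  polynomial_of_degree_le D (fun s => a * F s).
Proof. by move=> H; apply: (degree_leM (degree_le_cst 0 a) H). Qed.

Lemma degree_leW D D' F : (D <= D')%N ->
  polynomial_of_degree_le D F -> polynomial_of_degree_le D' F.
Proof. by move=> DD [P sP FP]; exists P => //; exact: leq_trans sP _. Qed.

Lemma degree_le_sum (I : Type) (r : seq I) D (F : I -> R -> R) :
  (forall i, polynomial_of_degree_le D (F i)) ->
  polynomial_of_degree_le D (fun s => \sum_(i <- r) F i s).
Proof.
move=> H; elim: r => [|i r IH].
  by under eq_fun do rewrite big_nil; exact: degree_le_cst.
by under eq_fun do rewrite big_cons; exact: degree_leD.
Qed.

Lemma degree_le_coord i : polynomial_of_degree_le 1 (fun s => (u + s *: w) 0 i).
Proof.
exists ((u 0 i)%:P + w 0 i *: 'X) => [|s].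
  rewrite (leq_trans (size_polyD _ _)) // geq_max.
  by rewrite (leq_trans (size_polyC_leq1 _)) // (leq_trans (size_scale_leq _ _)) ?size_polyX.
by rewrite !mxE !hornerE mulrC.
Qed.

Lemma is_polynomial_on_line (p : 'rV[R]_n -> R) : is_polynomial p ->
  exists P : {poly R}, forall s, p (u + s *: w) = P.[s].
Proof.
move: p; apply: is_polynomial_ind => [p q pq [P PE]|a|i|p q _ _ [P PE] [Q QE]|
    p q _ _ [P PE] [Q QE]].
- by exists P => s; rewrite pq PE.
- by exists a%:P => s; rewrite hornerC.
- by have [P _ PE] := degree_le_coord i; exists P.
- by exists (P + Q) => s; rewrite hornerD PE QE.
- by exists (P * Q) => s; rewrite hornerM PE QE.
Qed.

Lemma degree_le_mform c k t :
  polynomial_of_degree_le k (fun s => mform c (nseq k (u + s *: w)) t).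
Proof.
elim: k t => [|k IH] t; first exact: degree_le_cst.
by apply: degree_le_sum => i; apply: (degree_leM (degree_le_coord i)).
Qed.

Lemma degree_le_sqnormX k :
  polynomial_of_degree_le (2 * k) (fun s => sqnorm (u + s *: w) ^+ k).
Proof.
elim: k => [|k IH].
  by under eq_fun do rewrite expr0; exact: degree_le_cst.
under eq_fun do rewrite exprS.
rewrite mulnS; apply: degree_leM => //; apply: degree_le_sum => i.
by under eq_fun do rewrite expr2; apply: (degree_leM (degree_le_coord i) (degree_le_coord i)).
Qed.

End restriction_to_a_line.

Section model_on_a_line.
Variables (R : realType) (n : nat) (d : nat) (c : seq 'I_n -> R) (x : 'rV[R]_n).
Hypothesis hd : (3 <= d)%N.
Hypothesis od : odd d.
Hypothesis cP : perm_invariant d c.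

Lemma degree_le_model t u w :
  polynomial_of_degree_le d.+1 (fun s => model d c x t (u + s *: w)).
Proof.
apply: degree_leD.
  apply: degree_le_sum => k; apply: degree_leZ.
  apply: (@degree_leW _ k); first by rewrite ltnW // ltn_ord.
  under eq_fun do rewrite cats0 addrAC.
  exact: degree_le_mform.
apply: degree_leZ; under eq_fun do rewrite enorm_pow_sqnorm // addrAC.
apply: degree_leW (degree_le_sqnormX _ _ _); lia.
Qed.

Lemma model_on_line t u w : exists P : {poly R},
  [/\ (size P <= d.+2)%N, forall s, P.[s] = model d c x t (u + s *: w),
    forall s, P^`().[s] = model1 d c x t w (u + s *: w) &
    forall s, P^`()^`().[s] = model2 d c x t w (u + s *: w)].
Proof.
have [P sP PE] := degree_le_model t u w; exists P.
have E1 s : P^`().[s] = model1 d c x t w (u + s *: w).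
  have D := is_derive_line (is_derive_model x hd od cP t w (u + s *: w)).
  rewrite -(@derive_val _ _ _ _ _ _ _ (is_derive_poly P s)) -(@derive_val _ _ _ _ _ _ _ D).
  by congr ('D_1 _ s); apply/funext => r; rewrite PE.
split=> // s.
have D := is_derive_line (is_derive_model1 x hd od cP t w (u + s *: w)).
rewrite -(@derive_val _ _ _ _ _ _ _ (is_derive_poly P^`() s)).
rewrite -(@derive_val _ _ _ _ _ _ _ D).
by congr ('D_1 _ s); apply/funext => r; rewrite E1.
Qed.

(** Substituting (u + s w, w) in the SOS certificate of the Hessian form turns it into one for P''
    in the single variable s. As P has degree at most d + 1 = 2 (d./2) + 2, the extremal inequality
    applies with m = d./2. *)
Lemma model2_le_increment t u w : sos_convex (model d c x t) ->
  model2 d c x t w u / (d./2).+1%:R ^+ 2 <=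
  model1 d c x t w (u + w) - model1 d c x t w u.
Proof.
move=> [_ [qs qsE]]; have [P [sP _ P1 P2]] := model_on_line t u w.
have lineP (q : mpoly.mpoly (n + n) R) : exists r : {poly R},
    forall s, poly_fun q (row_mx (u + s *: w) w) = r.[s].
  have [|r rE] := @is_polynomial_on_line R _ (row_mx u w) (row_mx w 0) (poly_fun q).
    by exists q.
  exists r => s; rewrite -rE; congr poly_fun.
  by rewrite scale_row_mx add_row_mx scaler0 addr0.
have [r rE] := choice lineP.
have PS : P^`()^`() = \sum_(q <- [seq r q | q <- qs]) q ^+ 2.
  apply: horner_inj => s; rewrite P2 -(quad_form_hessian_model x hd od cP).
  have := qsE (row_mx (u + s *: w) w); rewrite row_mxKl row_mxKr => ->.
  rewrite horner_sum big_map; apply: eq_bigr => q _.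
  by rewrite rE horner_exp.
have := @sos_second_derivative_le R d./2 P _ _ PS.
rewrite P2 !P1 scale1r scale0r addr0; apply.
by rewrite (leq_trans sP) //; lia.
Qed.

End model_on_a_line.

(** * Newton steps *)

Section newton_method.
Variables (R : realType) (n d m : nat) (f : 'rV[R]_n -> R).
Variables (mu L M : R) (g : 'I_m -> 'rV[R]_n -> R) (xs : 'rV[R]_n).
Hypothesis hd3 : (3 <= d)%N.
Hypothesis hdodd : odd d.
Hypothesis hf : continuously_differentiable d f.
Hypothesis hmu : 0 < mu.
Hypothesis hsc : forall x : 'rV[R]_n, psd (hessian f x - mu%:M).
Hypothesis hL : 0 < L.
Hypothesis hlip : forall x y : 'rV[R]_n,
  tensor_norm (nabla d f y - nabla d f x) <= L * enorm (y - x).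
Hypothesis hM : L <= M.
Hypothesis hg : forall i : 'I_m, sos_convex (g i).
Hypothesis hxs : argmin (feasible g) f = [set xs].

Let c x := partials f x.
Let wt x := Num.max (M / d.+1`!%:R) (sos_shift d f x).

Let cP x : perm_invariant d (c x).
Proof. exact: perm_invariant_partials. Qed.

Let hf2 : continuously_differentiable 2 f.
Proof. by apply: continuously_differentiableW hf; lia. Qed.

Let xs_min : feasible g xs /\ forall z, feasible g z -> f xs <= f z.
Proof. by have : argmin (feasible g) f xs by rewrite hxs. Qed.

Lemma hessian_ge x w : mu * sqnorm w <= quad_form (hessian f x) w.
Proof.
rewrite -subr_ge0; have := hsc x w; congr (0 <= _).
rewrite /quad_form mulmxBr mulmxBl [LHS]mxE [X in _ + X]mxE; congr (_ - _).
rewrite mul_mx_scalar -scalemxAl mxE; congr (_ * _).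
by rewrite mxE; apply: eq_bigr => i _; rewrite mxE expr2.
Qed.

Lemma strongly_convex x w a : 0 <= a <= 1 ->
  f (x + a *: w) <= (1 - a) * f x + a * f (x + w) - mu * sqnorm w / 2 * (a * (1 - a)).
Proof. by move=> a01; apply: convex_on_line => // y; exact: hessian_ge. Qed.

Lemma growth y : feasible g y -> mu / 4 * sqnorm (y - xs) <= f y - f xs.
Proof.
move=> Cy; have h01 : 0 <= (2^-1 : R) <= 1 by apply/andP; split; lra.
have [Cxs xsmin] := xs_min.
(* Comparing [xs] with the midpoint of [xs] and [y] is what produces mu/4. *)
have := xsmin _ (@feasible_convex R n m g xs y 2^-1 hg h01 Cxs Cy).
have := strongly_convex xs (y - xs) h01.
by rewrite (addrC xs (y - xs)) subrK => H1 H2; lra.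
Qed.

Lemma psiE x : psi d f M x = model d (c x) x (wt x).
Proof. by apply/funext => y; rewrite /psi /model -taylor_tpoly. Qed.

Let taylor_modelE x t :
  (fun y => taylor d f x y + t * enorm (y - x) ^+ d.+1) = model d (c x) x t.
Proof. by apply/funext => y; rewrite taylor_tpoly. Qed.

Let shifts x := [set t : R | 0 <= t /\
  sos_convex (fun y => taylor d f x y + t * enorm (y - x) ^+ d.+1)].

(** One shift works for all centres in the ball: the derivatives of f are bounded there by
    compactness, and [sos_convex_model] gives a constant depending on that bound and on [mu]. *)
Lemma shifts_bounded r : exists2 B, 0 <= B &
  forall z, enorm (z - xs) <= r -> shifts z B.
Proof.
have r0 : 0 <= Num.max r 0 by rewrite le_max lexx orbT.
have [K K0 HK] := partials_bounded xs hf r0.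
have [B B0 HB] := @sos_convex_model R n d mu K hd3 hdodd hmu K0.
exists B => // z zr; split=> //; rewrite taylor_modelE; apply: HB => // [t td|w].
  by apply: HK => //; rewrite le_max zr.
by rewrite -quad_form_hessian hessian_ge.
Qed.

Lemma shifts_neq0 x : shifts x !=set0.
Proof. by have [B _ /(_ x (lexx _)) ?] := shifts_bounded (enorm (x - xs)); exists B. Qed.

Lemma sos_shift_le x B : shifts x B -> sos_shift d f x <= B.
Proof. by move=> xB; apply: ge_inf => //; exists 0 => t []. Qed.

Let from_shifts x (a b : R) :
  (forall t, sos_convex (model d (c x) x t) -> 0 <= a + t * b) -> 0 <= a + wt x * b.
Proof.
apply: (@inf_shift_linear R n d (c x) x hd3 hdodd (cP x) (shifts x)).
- by move=> t [_]; rewrite taylor_modelE.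
- exact: shifts_neq0.
- by rewrite -[inf _]/(sos_shift d f x) /wt le_max lexx orbT.
Qed.

Lemma psi_hessian_ge0 x v y : 0 <= model2 d (c x) x (wt x) v y.
Proof.
apply: from_shifts => t tS; rewrite -/(model2 d (c x) x t v y).
by rewrite -quad_form_hessian_model //; exact: sos_convex_quad_form_ge0.
Qed.

Lemma psi_hessian_le_increment x u w :
  model2 d (c x) x (wt x) w u / (d./2).+1%:R ^+ 2 <=
  model1 d (c x) x (wt x) w (u + w) - model1 d (c x) x (wt x) w u.
Proof.
rewrite -subr_ge0 /model1 /model2.
set T1 := tpoly _ _ _ _; set T2 := tpoly _ _ _ _; set T3 := tpoly _ _ _ _.
set E1 := d.+1%:R * _; set E2 := d.+1%:R * _; set E3 := d.+1%:R * _.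
set k := _ ^+ 2.
(* The inequality is put in the form a + wt x * b, as [from_shifts] requires. *)
have -> : T1 + wt x * E1 - (T2 + wt x * E2) - (T3 + wt x * E3) / k =
    (T1 - T2 - T3 / k) + wt x * (E1 - E2 - E3 / k) by ring.
apply: from_shifts => t tS.
have := model2_le_increment hd3 hdodd (cP x) u w tS; rewrite -subr_ge0.
by congr (0 <= _); rewrite /model1 /model2 -/T1 -/T2 -/T3 -/E1 -/E2 -/E3 -/k; ring.
Qed.

Let psi_smooth x : continuously_differentiable 2 (model d (c x) x (wt x)).
Proof. exact/is_polynomial_smooth/is_polynomial_model. Qed.

Lemma psi_convex x y w a : 0 <= a <= 1 ->
  model d (c x) x (wt x) (y + a *: w) <=
  (1 - a) * model d (c x) x (wt x) y + a * model d (c x) x (wt x) (y + w).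
Proof.
move=> a01; have := @convex_on_line R n _ 0 y w (psi_smooth x) _ a a01.
rewrite !mul0r subr0; apply=> z.
by rewrite quad_form_hessian_model //; exact: psi_hessian_ge0.
Qed.

Lemma taylor_error x y :
  `|f y - tpoly (c x) d [::] (y - x)| <= L / d.+1`!%:R * enorm (y - x) ^+ d.+1.
Proof.
have := taylor_mform_estimate hf hlip (us := [::]) x (y - x) (leq0n d).
rewrite /= (addrC x) subrK big_nil mulr1 subn0 => H.
by rewrite mulrAC.
Qed.

Lemma le_model x y : f y <= model d (c x) x (wt x) y.
Proof.
have := taylor_error x y; rewrite ler_norml => /andP[_].
rewrite /model lerBlDl => /le_trans; apply; rewrite lerD2l.
rewrite ler_wpM2r ?exprn_ge0 ?enorm_ge0 // /wt le_max; apply/orP; left.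
by rewrite ler_wpM2r // invr_ge0.
Qed.

Lemma model_le x y : model d (c x) x (wt x) y <=
  f y + (L / d.+1`!%:R + wt x) * enorm (y - x) ^+ d.+1.
Proof.
have := taylor_error x y; rewrite ler_norml => /andP[+ _].
by rewrite /model mulrDl; lra.
Qed.

Lemma model_argmin_exists x : exists2 y, feasible g y &
  forall z, feasible g z -> model d (c x) x (wt x) y <= model d (c x) x (wt x) z.
Proof.
have [Cxs xsmin] := xs_min.
set p := model d (c x) x (wt x).
have pC : continuous p.
  exact/is_polynomial_continuous/is_polynomial_model.
have D0 : 0 <= 4 / mu * (p xs - f xs).
  apply: mulr_ge0; last by rewrite subr_ge0 le_model.
  by apply: divr_ge0 => //; exact: ltW.
(* Outside this radius growth gives f z >= p xs, hence p z >= p xs, so minimizing over the compact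
   part is enough. *)
pose r := Num.sqrt (4 / mu * (p xs - f xs)).
pose A := feasible g `&` [set z | enorm (z - xs) <= r].
have r0 : 0 <= r by exact: sqrtr_ge0.
have Axs : A xs by split => //=; rewrite subrr enorm0.
have [|||y] := @EVT_min_rV R n p A.
- by exists xs.
- rewrite /A setIC; apply: compact_closedI; first exact: compact_enorm_ball.
  exact: feasible_closed.
- exact: continuous_subspaceT.
rewrite inE => -[Cy _] ymin; exists y => // z Cz.
have [zr|rz] := leP (enorm (z - xs)) r; first by apply: ymin; rewrite inE.
rewrite (le_trans (ymin xs _)) ?inE // (le_trans _ (le_model x z)) //.
have := growth Cz; rewrite sqnormE.
have : r ^+ 2 <= enorm (z - xs) ^+ 2 by rewrite ler_sqr ?nnegrE ?enorm_ge0 // ltW.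
rewrite sqr_sqrtr // => H1 H2.
have := ler_wpM2l (ltW (divr_gt0 hmu (ltr0n R 4 : 0 < 4))) H1.
have -> : mu / 4 * (4 / mu * (p xs - f xs)) = p xs - f xs.
  by field; rewrite gt_eqF.
lra.
Qed.

(** By convexity the model is constant between two minimizers; being polynomial it is constant on
    their whole line, where it would bound the strongly convex f from above. *)
Lemma model_argmin_unique x y1 y2 : feasible g y1 -> feasible g y2 ->
  (forall z, feasible g z -> model d (c x) x (wt x) y1 <= model d (c x) x (wt x) z) ->
  (forall z, feasible g z -> model d (c x) x (wt x) y2 <= model d (c x) x (wt x) z) ->
  y1 = y2.
Proof.
set p := model d (c x) x (wt x) => C1 C2 m1 m2.
apply/eqP; apply: contraT => ne; pose w := y2 - y1.
have w0 : 0 < sqnorm w.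
  by rewrite sqnormE exprn_gt0 // enorm_gt0 // subr_eq0 eq_sym.
have e12 : p y1 = p y2 by apply/le_anti; rewrite m1 // m2.
have cst s : 0 <= s <= 1 -> p (y1 + s *: w) = p y1.
  move=> s01; apply/le_anti; rewrite m1 ?andbT; last exact: feasible_convex.
  have := psi_convex x y1 w s01; rewrite -/p {3}/w (addrC y1 (y2 - y1)) subrK -e12.
  by rewrite -mulrDl subrK mul1r.
have [P [_ PE _ _]] := model_on_line x hd3 hdodd (cP x) (wt x) y1 w.
have P0 : P - (p y1)%:P = 0.
  (* The points 1/(i + 1) are as many distinct roots in [0, 1] as the size of the polynomial
     demands. *)
  apply: (@roots_geq_poly_eq0 _ _ [seq (i.+1%:R)^-1 | i <- iota 0 (size (P - (p y1)%:P))]).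
  - apply/allP => _ /mapP[i _ ->]; rewrite /root hornerD hornerN hornerC PE -/p.
    rewrite cst ?subrr // invr_ge0 ler0n invf_le1 ?ltr0n //.
    by rewrite ler1n.
  - rewrite map_inj_uniq ?iota_uniq // => i j /invr_inj /eqP.
    by rewrite eqr_nat eqSS => /eqP.
  - by rewrite size_map size_iota.
have const s : f (y1 + s *: w) <= p y1.
  rewrite (le_trans (le_model x _)) // -PE -[P](subrK (p y1)%:P) P0 add0r.
  by rewrite hornerC.
(* Strong convexity between y1 - s w and y1 + s w yields mu |w|^2 s^2 <= 2 (p y1 - f y1) = mu |w|^2
   (s - 1), impossible for s >= 1. *)
pose s := 1 + 2 * (p y1 - f y1) / (mu * sqnorm w).
have py : 0 <= p y1 - f y1 by rewrite subr_ge0 le_model.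
have mw : 0 < mu * sqnorm w by rewrite mulr_gt0.
have s1 : 1 <= s by rewrite lerDl divr_ge0 ?mulr_ge0 // ltW.
have h01 : 0 <= (2^-1 : R) <= 1 by apply/andP; split; lra.
have := strongly_convex (y1 - s *: w) ((2 * s) *: w) h01.
have -> : y1 - s *: w + 2^-1 *: ((2 * s) *: w) = y1.
  by rewrite scalerA mulKf // subrK.
have -> : y1 - s *: w + (2 * s) *: w = y1 + s *: w.
  by rewrite -addrA -scaleNr -scalerDl; congr (_ + _ *: _); ring.
have -> : sqnorm ((2 * s) *: w) = 4 * s ^+ 2 * sqnorm w.
  rewrite !sqnormE enormZ (exprMn _ `|_|) real_normK ?num_real //; ring.
have := const s; have := const (- s); rewrite scaleNr => H1 H2 H3.
have sE : mu * sqnorm w * s = mu * sqnorm w + 2 * (p y1 - f y1).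
  by rewrite /s; field; rewrite !gt_eqF.
have ss : 0 <= mu * sqnorm w * (s * (s - 1)).
  apply: mulr_ge0; first exact: ltW.
  by apply: mulr_ge0; rewrite ?subr_ge0 // (le_trans ler01).
clearbody s; move: H1 H2 H3 ss sE mw py; lra.
Qed.

(** Existence and uniqueness together exclude the default value of [xget]. *)
Lemma newton_stepP x : let y := newton_step d f M (feasible g) x in
  feasible g y /\
  forall z, feasible g z -> model d (c x) x (wt x) y <= model d (c x) x (wt x) z.
Proof.
rewrite /newton_step psiE /=.
have [y0 C0 m0] := model_argmin_exists x.
have H : argmin (feasible g) (model d (c x) x (wt x)) = [set y0].
  apply/seteqP; split=> [y [Cy my]|_ ->] //=; exact: model_argmin_unique m0.
have -> : xget 0 [set y | argmin (feasible g) (model d (c x) x (wt x)) = [set y]] = y0.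
  by apply: xget_unique => // y; rewrite H => /seteqP[+ _] => /(_ y0 erefl).
by [].
Qed.

Lemma wt_le x B : shifts x B -> wt x <= Num.max (M / d.+1`!%:R) B.
Proof. by move=> /sos_shift_le H; rewrite /wt ge_max !le_max lexx H orbT. Qed.

Let M_ge0 : 0 <= M.
Proof. exact: le_trans (ltW hL) hM. Qed.

Let wt_ge0 x : 0 <= wt x.
Proof. by rewrite /wt le_max divr_ge0. Qed.

Lemma newton_step_le x z : feasible g z ->
  f (newton_step d f M (feasible g) x) <=
  f z + (L / d.+1`!%:R + wt x) * enorm (z - x) ^+ d.+1.
Proof.
move=> Cz; have [_ /(_ z Cz) H] := newton_stepP x.
exact: le_trans (le_model x _) (le_trans H (model_le x z)).
Qed.

Lemma newton_converges (x : nat -> 'rV[R]_n) :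
  (forall k : nat, x k.+1 = newton_step d f M (feasible g) (x k)) ->
  x k @[k --> \oo] --> xs.
Proof.
have dS : d.+1 = (2 + d.-1)%N by lia.
(* Indices are shifted by one since the starting point x 0 may be infeasible. *)
move=> xE; pose delta k := f (x k.+1) - f xs.
have [Cxs xsmin] := xs_min.
have Cx k : feasible g (x k.+1) by rewrite xE; have [] := newton_stepP (x k).
have delta0 k : 0 <= delta k by rewrite subr_ge0 xsmin.
have deltaS k : delta k.+1 <= delta k.
  rewrite lerD2r xE (le_trans (newton_step_le _ (Cx k))) //.
  by rewrite subrr enorm0 expr0n mulr0 addr0.
have delta_mono k j : delta (j + k)%N <= delta k.
  by elim: j => [//|j IH]; exact: le_trans (deltaS _) IH.
have far k : mu / 4 * enorm (x k.+1 - xs) ^+ 2 <= delta k.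
  by rewrite -sqnormE; exact: growth.
(* Values decrease from x 1 on, so growth confines those iterates to the ball of radius [D], where
   the shifts have a common bound. *)
pose D := Num.sqrt (4 / mu * delta 0%N).
have mu4 : 0 <= 4 / mu by apply: divr_ge0 => //; exact: ltW.
have D2 : D ^+ 2 = 4 / mu * delta 0%N by rewrite sqr_sqrtr // mulr_ge0.
have xD k : enorm (x k.+1 - xs) <= D.
  rewrite -ler_sqr ?nnegrE ?enorm_ge0 ?sqrtr_ge0 // D2.
  have := delta_mono 0%N k; rewrite addn0 => /(le_trans (far k)) /(ler_wpM2l mu4).
  rewrite mulrA (_ : 4 / mu * (mu / 4) = 1); last by field; rewrite gt_eqF.
  by rewrite mul1r.
have [B B0 HB] := shifts_bounded D.
pose K := (L / d.+1`!%:R + Num.max (M / d.+1`!%:R) B) * D ^+ d.+1.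
have L0 : 0 <= L / d.+1`!%:R by apply: divr_ge0 => //; exact: ltW.
have K0 : 0 <= K.
  apply: mulr_ge0; last by rewrite exprn_ge0 // sqrtr_ge0.
  by rewrite addr_ge0 // le_max B0 orbT.
have step a k : 0 <= a <= 1 -> delta k.+1 <= (1 - a) * delta k + K * a ^+ d.+1.
  move=> a01; have /andP[a0 a1] := a01.
  have Cz := feasible_convex hg a01 (Cx k) Cxs.
  have := newton_step_le (x k.+1) Cz; rewrite -xE => H.
  have := strongly_convex (x k.+1) (xs - x k.+1) a01.
  rewrite (addrC (x k.+1) (xs - _)) subrK => Hc.
  have sq0 : 0 <= mu * sqnorm (xs - x k.+1) / 2 * (a * (1 - a)).
    apply: mulr_ge0; last by apply: mulr_ge0 => //; rewrite subr_ge0.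
    by apply: divr_ge0 => //; apply: mulr_ge0; [exact: ltW|rewrite sqnormE sqr_ge0].
  have err : (L / d.+1`!%:R + wt (x k.+1)) *
      enorm (x k.+1 + a *: (xs - x k.+1) - x k.+1) ^+ d.+1 <= K * a ^+ d.+1.
    rewrite (addrC (x k.+1)) addrK enormZ ger0_norm // exprMn mulrCA mulrC.
    apply: ler_wpM2r; first exact: exprn_ge0.
    apply: ler_pM; rewrite ?addr_ge0 ?exprn_ge0 ?enorm_ge0 //.
      by rewrite lerD2l; apply: wt_le; apply: HB.
    by rewrite lerXn2r ?nnegrE ?enorm_ge0 ?sqrtr_ge0 // enorm_distC.
  rewrite /delta; move: H Hc sq0 err; lra.
clearbody K; pose l := inf (range delta).
have rn : range delta !=set0 by exists (delta 0%N); exists 0%N.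
have l_le k : l <= delta k.
  by apply: ge_inf; [exists 0 => _ [j _ <-]|exists k].
have l_lt e : 0 < e -> exists k, delta k < l + e.
  move=> e0; have := @inf_lt R (range delta) (l + e) rn.
  by rewrite ltrDl => /(_ e0)[_ [k _ <-] H]; exists k.
have l_le0 : l <= 0.
  (* If l > 0, take a with K a < l. A value below l + a (l - K a) is sent by one step to below l -
     a^2 (l - K a), under the infimum. *)
  rewrite leNgt; apply/negP => l0.
  pose a := Num.min 1 (l / (K + 1)).
  have K1 : 0 < K + 1 by rewrite ltr_wpDl.
  have a0 : 0 < a by rewrite lt_min ltr01 divr_gt0.
  have a1 : a <= 1 by rewrite ge_min lexx.
  have aK : K * a < l.
    apply: (@le_lt_trans _ _ (K * (l / (K + 1)))).
      by rewrite ler_wpM2l // ge_min lexx orbT.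
    by rewrite mulrA ltr_pdivrMr // mulrC ltr_pM2l // ltrDl.
  clearbody a; have ad : K * a ^+ d.+1 <= K * a * a.
    have -> : a ^+ d.+1 = a * a * a ^+ d.-1.
      by rewrite dS exprD expr2.
    have a0' := ltW a0; rewrite -[K * a * a]mulrA ler_wpM2l // ler_piMr ?mulr_ge0 //.
    exact: exprn_ile1.
  have aK0 : 0 < l - K * a by rewrite subr_gt0.
  have [k Hk] := l_lt (a * (l - K * a)) (mulr_gt0 a0 aK0).
  have := le_trans (l_le k.+1) (step a k _).
  rewrite (ltW a0) a1 => /(_ isT) H.
  have H2 : (1 - a) * delta k <= (1 - a) * (l + a * (l - K * a)).
    by rewrite ler_wpM2l ?subr_ge0 // ltW.
  have a2 : 0 < a * (a * (l - K * a)) by rewrite !mulr_gt0 // subr_gt0.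
  move: H H2 ad a2; lra.
apply/cvgrPdist_lt => e e0.
have e4 : 0 < mu / 4 * e ^+ 2 by rewrite mulr_gt0 ?divr_gt0 ?exprn_gt0.
have [k0 Hk0] := l_lt _ e4.
exists k0.+1 => // k /=; case: k => // k; rewrite ltnS => kk.
rewrite distrC (le_lt_trans (norm_le_enorm _)) //.
rewrite -ltr_sqr ?nnegrE ?enorm_ge0 ?(ltW e0) //.
rewrite -(ltr_pM2l (_ : 0 < mu / 4)) ?divr_gt0 //.
rewrite (le_lt_trans (far k)) // -(subnK kk) (le_lt_trans (delta_mono _ _)) //.
by rewrite (lt_le_trans Hk0) // gerDr.
Qed.

Lemma newton_local_estimate x :
  enorm (x - xs) ^+ d.-1 <= (d.-1)`!%:R * mu / (2 * L) ->
  enorm (newton_step d f M (feasible g) x - xs) <=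
    (d.+1%:R / 2) ^+ 2 * (2 / mu) * (L / d`!%:R + wt x * d.+1%:R) * enorm (x - xs) ^+ d.
Proof.
have dd : (d.-1 = 2 * d./2)%N by lia.
have dS : (d.-1.+1 = d)%N by lia.
have dSS : (d.-2.+1 = d.-1)%N by lia.
have d1 : (1 <= d)%N by lia.
have d2 : (2 <= d)%N by lia.
have kN : ((d./2).+1 * 2 = d.+1)%N by lia.
move=> xr; have [Cxs xsmin] := xs_min; have [] := newton_stepP x.
set xp := newton_step _ _ _ _ _ => Cp pmin.
pose w := xp - xs; pose h := xs - x; set rho := enorm (x - xs) in xr *.
have rhoE : enorm h = rho by rewrite /h enorm_distC.
have rho0 : 0 <= rho by exact: enorm_ge0.
clearbody rho.
have L0 k : 0 <= L / k`!%:R by apply: divr_ge0 => //; exact: ltW.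
pose q := (L / d`!%:R + wt x * d.+1%:R) * rho ^+ d.
have q0 : 0 <= q by rewrite mulr_ge0 ?exprn_ge0 // addr_ge0 // mulr_ge0.
have mu2 : 0 <= 2 / mu by apply: divr_ge0 => //; exact: ltW.
rewrite -/w -[X in _ <= X]mulrA -/q.
have [->|w0] := eqVneq w 0.
  rewrite enorm0; apply: mulr_ge0 => //; apply: mulr_ge0 => //; exact: sqr_ge0.
have ew : 0 < enorm w by exact: enorm_gt0.
have seg s : 0 <= s <= 1 -> feasible g (xs + s *: w).
  by move=> s01; exact: feasible_convex.
have xpE : xs + w = xp by rewrite addrC subrK.
(* Optimality of [xs] for f on the feasible segment towards x^+; [D2] is optimality of x^+ for the
   model on the same segment, looking back. *)
have D1 : 0 <= mform (c xs) [:: w] [::].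
  have Df : is_derive (0 : R) (1 : R) (fun s : R => f (xs + s *: w)) (mform (c xs) [:: w] [::]).
    by apply: is_derive_line; rewrite scale0r addr0; exact: is_derive_partials_form.
  rewrite -[X in 0 <= X]mul1r; apply: (derive_ge0_at_min Df) => t /andP[t0 t1].
  by rewrite scale0r addr0 add0r mulr1; apply/xsmin/seg; rewrite (ltW t0).
have D2 : model1 d (c x) x (wt x) w (xs + w) <= 0.
  have Dp : is_derive (1 : R) (1 : R) (fun s : R => model d (c x) x (wt x) (xs + s *: w))
      (model1 d (c x) x (wt x) w (xs + w)).
    by apply: is_derive_line; rewrite scale1r; exact: is_derive_model.
  rewrite -oppr_ge0 -mulN1r; apply: (derive_ge0_at_min Dp) => t /andP[t0 t1].
  by rewrite scale1r xpE mulrN1; apply/pmin/seg; apply/andP; split; lra.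
have hd : sqnorm h ^+ d./2 = rho ^+ d.-1 by rewrite sqnormE rhoE -exprM -dd.
have rhod : rho ^+ d = rho ^+ d.-1 * rho by rewrite -{1}dS exprSr.
(* The gradient of the model at [xs] differs from that of f by a Taylor error, the L/d! part of [q],
   and by the gradient of the regularizing term, its other part. *)
have D3 : - (q * enorm w) <= model1 d (c x) x (wt x) w xs.
  have := @taylor_mform_estimate R n d f hf L hlip [:: w] x h d1.
  rewrite [(d - size _)%N]/= subn1 dS.
  rewrite big_seq1 rhoE (addrC x) subrK => H1.
  have H2 := cauchy_schwarz h w; rewrite rhoE in H2.
  rewrite /model1 -/h hd.
  have H3 : - (wt x * (d.+1%:R * (rho ^+ d * enorm w))) <=
      wt x * (d.+1%:R * (rho ^+ d.-1 * dotp h w)).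
    rewrite -!mulrN ler_wpM2l // ler_wpM2l // rhod -mulrA ler_wpM2l ?exprn_ge0 //.
    by move: H2; rewrite ler_norml mulrN => /andP[].
  move: H1; rewrite ler_norml => /andP[_ H1].
  by rewrite /tpoly dS /q; move: D1 H1 H3; lra.
(* The bound on |x - xs| keeps the Taylor error of the Hessian at [xs] below mu/2; the regularizing
   term only adds a nonnegative amount. *)
have D4 : mu / 2 * enorm w ^+ 2 <= model2 d (c x) x (wt x) w xs.
  have := @taylor_mform_estimate R n d f hf L hlip [:: w; w] x h d2.
  rewrite [(d - size _)%N]/= subn2 dSS.
  rewrite big_cons big_seq1 rhoE (addrC x) subrK => H1.
  have H2 := hessian_ge xs w; rewrite quad_form_hessian sqnormE in H2.
  have E0 : 0 <= wt x * (d.+1%:R * (sqnorm h ^+ d./2 * sqnorm w +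
     d.-1%:R * (sqnorm h ^+ d./2.-1 * dotp h w ^+ 2))).
    have s0 v : 0 <= sqnorm v by rewrite sqnormE sqr_ge0.
    apply: mulr_ge0 => //; apply: mulr_ge0 => //; apply: addr_ge0.
      by apply: mulr_ge0; [exact/exprn_ge0/s0|exact: s0].
    apply: mulr_ge0; first exact: ler0n.
    by apply: mulr_ge0; [exact/exprn_ge0/s0|exact: sqr_ge0].
  rewrite /model2 -/h /tpoly dSS; set E := wt x * _ in E0 *.
  have H3 : L * rho ^+ d.-1 * (enorm w * enorm w) / d.-1`!%:R <= mu / 2 * enorm w ^+ 2.
    rewrite mulrAC -expr2 ler_wpM2r ?sqr_ge0 //.
    rewrite ler_pdivrMr ?ltr0n ?fact_gt0 // (le_trans (ler_wpM2l (ltW hL) xr)) //.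
    by rewrite le_eqVlt; apply/orP; left; apply/eqP; field; rewrite gt_eqF.
  move: H1; rewrite ler_norml => /andP[_ H1].
  by move: H1 H2 H3 E0; lra.
have D5 := psi_hessian_le_increment x xs w.
have kE : (d./2).+1%:R = d.+1%:R / 2 :> R.
  by apply: (mulIf (_ : 2 != 0 :> R)) => //; rewrite divfK // -natrM kN.
rewrite kE in D5.
have k0 : 0 < (d.+1%:R / 2) ^+ 2 :> R by rewrite exprn_gt0 // divr_gt0.
have D6 : mu / 2 * enorm w ^+ 2 <= (d.+1%:R / 2) ^+ 2 * (q * enorm w).
  rewrite (le_trans D4) // mulrC -ler_pdivrMr // (le_trans D5) //.
  by move: D2 D3; lra.
rewrite -(ler_pM2r ew) -expr2.
have -> : enorm w ^+ 2 = 2 / mu * (mu / 2 * enorm w ^+ 2) by field; rewrite gt_eqF.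
rewrite (le_trans (ler_wpM2l mu2 D6)) // le_eqVlt; apply/orP; left; apply/eqP; ring.
Qed.

Lemma newton_local_rate r x : r ^+ d.-1 <= (d.-1)`!%:R * mu / (2 * L) ->
  enorm (x - xs) <= r ->
  enorm (newton_step d f M (feasible g) x - xs) <=
    (d.+1%:R / 2) ^+ 2 * (2 / mu) *
    (L / d`!%:R + Num.max (M / d.+1`!%:R)
       (sup [set sos_shift d f z | z in [set z | enorm (z - xs) <= r]]) * d.+1%:R)
    * enorm (x - xs) ^+ d.
Proof.
move=> rL xr; have [B B0 HB] := shifts_bounded r.
have xL : enorm (x - xs) ^+ d.-1 <= (d.-1)`!%:R * mu / (2 * L).
  apply: le_trans rL; rewrite lerXn2r ?nnegrE ?enorm_ge0 //.
  exact: le_trans (enorm_ge0 _) xr.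
apply: le_trans (newton_local_estimate xL) _.
apply: ler_wpM2r; first by rewrite exprn_ge0 // enorm_ge0.
apply: ler_wpM2l.
  by apply: mulr_ge0; [exact: sqr_ge0|apply: divr_ge0 => //; exact: ltW].
rewrite lerD2l; apply: ler_wpM2r => //.
rewrite /wt ge_max !le_max lexx /=; apply/orP; right.
apply: ub_le_sup; last by exists x.
(* The supremum of t over the ball is an upper bound only because t is bounded there. *)
by exists B => _ [z zr <-]; apply/sos_shift_le/HB.
Qed.

End newton_method.

Theorem theorem7p2 (R : realType) (n d m : nat) (f : 'rV[R]_n -> R)
    (mu L M : R) (g : 'I_m -> 'rV[R]_n -> R) (xs : 'rV[R]_n)
    (hd3 : (3 <= d)%N) (hdodd : odd d)
    (hf : continuously_differentiable d f)
    (hmu : 0 < mu) (hsc : forall x : 'rV[R]_n, psd (hessian f x - mu%:M))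
    (hL : 0 < L)
    (hlip : forall x y : 'rV[R]_n,
       tensor_norm (nabla d f y - nabla d f x) <= L * enorm (y - x))
    (hM : L <= M)
    (hg : forall i : 'I_m, sos_convex (g i))
    (hint : interior (feasible g) !=set0)
    (hxs : argmin (feasible g) f = [set xs]) :
  (forall x : nat -> 'rV[R]_n,
     (forall k : nat, x k.+1 = newton_step d f M (feasible g) (x k)) ->
     x k @[k --> \oo] --> xs)
  /\
  (let r := ((d.-1)`!%:R * mu / (2 * L)) `^ (d.-1%:R)^-1 in
   forall x : 'rV[R]_n, enorm (x - xs) <= r ->
     enorm (newton_step d f M (feasible g) x - xs) <=
       (d.+1%:R / 2) ^+ 2 * (2 / mu) *
       (L / d`!%:R +
        Num.max (M / d.+1`!%:R)
          (sup [set sos_shift d f z | z in [set z | enorm (z - xs) <= r]])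
        * d.+1%:R)
       * enorm (x - xs) ^+ d).
Proof.
split=> [x|r x].
  exact: (newton_converges hd3 hdodd hf hmu hsc hL hlip hM hg hxs).
apply: (newton_local_rate hd3 hdodd hf hmu hsc hL hlip hM hg hxs).
have a0 : 0 <= (d.-1)`!%:R * mu / (2 * L).
  by apply: divr_ge0; apply: mulr_ge0 => //; exact: ltW.
rewrite -powR_mulrn ?powR_ge0 // -powRrM mulVf ?powRr1 //.
by rewrite pnatr_eq0; lia.
Qed.
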